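(* Let $(M,g)$ be a Riemannian $n$-manifold with curvature tensor $R_{pijk}$. Then $M$ admits a local isometric immersion in $\mathbb{R}^{n+1}$ if and only if there exists locally on $M$ a scalar field $h$ satisfying $$\frac{h_{;pj}h_{;ik}-h_{;pk}h_{;ij}}{1-g^{ab}h_{;a}h_{;b}}=R_{pijk}\qquad\text{and}\qquad g^{ab}h_{;a}h_{;b}<1.$$
   Context: All manifolds, metrics and functions are smooth. The subscript '';'' denotes covariant differentiation with respect to the Levi-Civita connection of $g$; repeated upper/lower indices are summed. ''Locally'' means: on some open neighbourhood of each point of $M$. $(M,g)$ admits a local isometric immersion in $\mathbb{R}^{m}$ if there exists locally on $M$ an $m$-tuple of scalar fields $u^{(1)},\dots,u^{(m)}$ with $\sum_{\tau=1}^m u^{(\tau)}_{;a}u^{(\tau)}_{;b}=g_{ab}$. Curvature sign convention: the unit round sphere has $R_{pijk}=g_{pj}g_{ik}-g_{pk}g_{ij}$. *)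

(* Defs.v *)
From HB Require Import structures.
From mathcomp Require Import all_boot all_order all_algebra.
From mathcomp Require Import boolp classical_sets functions reals.
From mathcomp Require Import topology normedtype derive.

Set Implicit Arguments.
Unset Strict Implicit.
Unset Printing Implicit Defensive.

Import Order.TTheory GRing.Theory Num.Theory.
Import numFieldNormedType.Exports.

Local Open Scope classical_set_scope.
Local Open Scope ring_scope.

(** * Smooth functions on open subsets of R^n *)

Section Smooth.
Context {R : realType} {n : nat}.

Definition partial {W : normedModType R} (i : 'I_n) (f : 'rV[R]_n -> W)
    : 'rV[R]_n -> W :=
  fun x => 'D_(delta_mx 0 i) f x.

Fixpoint Ck_on {W : normedModType R} (k : nat) (U : set 'rV[R]_n)
    (f : 'rV[R]_n -> W) : Prop :=
  if k is k'.+1 then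
    (forall x, U x -> differentiable f x) /\
    (forall i, Ck_on k' U (partial i f))
  else {in U, continuous f}.

Definition smooth_on {W : normedModType R} (U : set 'rV[R]_n)
    (f : 'rV[R]_n -> W) : Prop :=
  forall k, Ck_on k U f.

End Smooth.

(** * Smooth manifolds *)

(* [chart_map] and [chart_inv] are total functions; only their values on
   [chart_dom] and [chart_cod] respectively are meaningful. *)
Record chart (R : realType) (n : nat) (M : topologicalType) := Chart {
  chart_dom : set M;
  chart_map : M -> 'rV[R]_n;
  chart_inv : 'rV[R]_n -> M }.

Section Charts.
Context {R : realType} {n : nat} {M : topologicalType}.
Implicit Types c d : chart R n M.

Definition chart_cod c : set 'rV[R]_n := chart_map c @` chart_dom c.

Definition is_chart c : Prop :=
  [/\ open (chart_dom c), open (chart_cod c),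
      {in chart_dom c, cancel (chart_map c) (chart_inv c)},
      {in chart_dom c, continuous (chart_map c)} &
      {in chart_cod c, continuous (chart_inv c)}].

Definition transition c d : 'rV[R]_n -> 'rV[R]_n :=
  chart_map d \o chart_inv c.

Definition overlap c d : set 'rV[R]_n :=
  chart_map c @` (chart_dom c `&` chart_dom d).

End Charts.

Record manifold (R : realType) (n : nat) := Manifold {
  carrier :> topologicalType;
  manifold_hausdorff : hausdorff_space carrier;
  manifold_second_countable : @second_countable carrier;
  atlas : set (chart R n carrier);
  atlas_chart : forall c, atlas c -> is_chart c;
  atlas_cover : forall p, exists2 c, atlas c & chart_dom c p;
  atlas_smooth : forall c d, atlas c -> atlas d ->
    smooth_on (overlap c d) (transition c d) }.

(* A metric is given by its components in every chart of the atlas, subject to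
   the transformation law of a (0,2)-tensor.  Vectors are rows, so the library
   Jacobian ['J f x] has entries (i, j) |-> d f^j / d x^i. *)
Record riemannian_metric (R : realType) (n : nat) (M : manifold R n) :=
    RiemannianMetric {
  metric_comp : chart R n M -> 'rV[R]_n -> 'M[R]_n;
  metric_smooth : forall c, atlas c ->
    smooth_on (chart_cod c) (metric_comp c);
  metric_sym : forall c, atlas c -> forall x, chart_cod c x ->
    (metric_comp c x)^T = metric_comp c x;
  metric_posdef : forall c, atlas c -> forall x, chart_cod c x ->
    forall v : 'rV[R]_n, v != 0 -> 0 < (v *m metric_comp c x *m v^T) 0 0;
  metric_transform : forall c d, atlas c -> atlas d ->
    forall x, overlap c d x ->
    metric_comp c x =
      'J (transition c d) x *m metric_comp d (transition c d x)
        *m ('J (transition c d) x)^T }.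

(** * Tensor calculus in coordinates

   [G x] is the matrix (g_ij) at [x], [invmx (G x)] the matrix (g^ij). *)

Section Coordinates.
Context {R : realType} {n : nat}.
Variable G : 'rV[R]_n -> 'M[R]_n.
Implicit Types (x : 'rV[R]_n) (h : 'rV[R]_n -> R).

(* Gamma^k_{ij} of the Levi-Civita connection *)
Definition christoffel (k i j : 'I_n) x : R :=
  2^-1 * \sum_l invmx (G x) k l *
    (partial i (fun y => G y l j) x + partial j (fun y => G y l i) x
     - partial l (fun y => G y i j) x).

(* w_{i;j} for a covector field with components [w] *)
Definition covector_deriv (w : 'I_n -> 'rV[R]_n -> R) (i j : 'I_n) x : R :=
  partial j (w i) x - \sum_k christoffel k i j x * w k x.

(* h_{;ij} *)
Definition hessian h (i j : 'I_n) x : R :=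
  covector_deriv (fun k => partial k h) i j x.

(* g^{ab} h_{;a} h_{;b} *)
Definition grad_sqnorm h x : R :=
  \sum_a \sum_b invmx (G x) a b * partial a h x * partial b h x.

(* R^m_{ijk}, the d_m-component of
   nabla_j (nabla_k d_i) - nabla_k (nabla_j d_i). *)
Definition riemann_up (m i j k : 'I_n) x : R :=
  partial j (christoffel m k i) x - partial k (christoffel m j i) x
  + \sum_l (christoffel m j l x * christoffel l k i x
            - christoffel m k l x * christoffel l j i x).

(* R_{pijk}; with this sign the unit round sphere has
   R_{pijk} = g_{pj} g_{ik} - g_{pk} g_{ij}. *)
Definition riemann (p i j k : 'I_n) x : R :=
  \sum_m G x p m * riemann_up m i j k x.

End Coordinates.

(** * Local statements on a manifold *)

Section Local.
Context {R : realType} {n : nat} {M : manifold R n}.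

Definition locally_on (P : set M -> Prop) : Prop :=
  forall q : M, exists W : set M, [/\ open W, W q & P W].

(* A scalar field on the open set [W] is a total function of which only the
   values on [W] matter. *)
Definition scalar_field_on (W : set M) (f : M -> R) : Prop :=
  forall c, atlas c ->
    smooth_on (chart_map c @` (W `&` chart_dom c)) (f \o chart_inv c).

Definition admits_local_isometric_immersion
    (g : riemannian_metric M) (m : nat) : Prop :=
  locally_on (fun W => exists u : 'I_m -> M -> R,
    (forall t, scalar_field_on W (u t)) /\
    forall c, atlas c -> forall q, W q -> chart_dom c q ->
    forall a b : 'I_n,
      \sum_t partial a (u t \o chart_inv c) (chart_map c q)
           * partial b (u t \o chart_inv c) (chart_map c q)
      = metric_comp g c (chart_map c q) a b).

End Local.

(* Main.v *)
Require Import Defs.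
From HB Require Import structures.
From mathcomp Require Import all_boot all_order all_algebra.
From mathcomp Require Import zify ring lra.
From mathcomp Require Import boolp classical_sets functions reals ereal.
From mathcomp Require Import topology normedtype landau sequences derive.
From mathcomp Require Import measure lebesgue_measure lebesgue_integral ftc.

Set Implicit Arguments.
Unset Strict Implicit.
Unset Printing Implicit Defensive.

Import Order.TTheory GRing.Theory Num.Theory.
Import numFieldNormedType.Exports.

Local Open Scope classical_set_scope.
Local Open Scope ring_scope.

(** A height function [h] of an immersion into R^{n+1} is one of its
    coordinates.  Near a point the other [n] coordinates then realize
    [g - dh (x) dh] as a flat metric, and the equation for [h] says exactly that
    this metric is flat.  Both implications are read off the matrices of the
    Levi-Civita connection.  Write [G] for the metric, [Gam j] for the matrix
    of the Christoffel symbols in the direction [j], [d] for the row of the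
    differential of [h], [K j] for the row of the [h_{;ij}] and
    [nu = 1 - |dh|^2].

    From an immersion to [h].  The Jacobian [W] of an isometric immersion
    satisfies [W^T W = G].  Its second fundamental form
    [X j = d_j W - W Gam j], whose rows are the Hessians of the coordinates,
    is normal: [W^T X j = 0] ([second_form_normal], Koszul's formula).
    Differentiating this relation and commuting the second derivatives of [W]
    gives the Gauss equation [G R_jk = X_j^T X_k - X_k^T X_j]
    ([gauss_equation]).  In codimension one the matrix
    [Q = 1 - W G^-1 W^T] projects onto a line, hence has rank one; since
    [Q X j = X j], the product of the entries of [X_j] and [X_k] in row [t] is
    [Q t t] times the corresponding entry of [X_j^T X_k].  As
    [Q t t = 1 - |d u^t|^2], every coordinate [u^t] satisfies the equation
    multiplied by its denominator ([hypersurface_gauss]).  The trace of [Q] is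
    one, so that at each point some [Q t t] is positive, and this coordinate
    is a height function nearby ([height_function_of_immersion]).

    From [h] to an immersion.  The matrix [H = G - d^T d] is positive definite
    because [nu > 0].  Its Christoffel matrices are
    [C j = Gam j - nu^-1 grad(h) K j]: they are symmetric in the lower indices
    and make [H] parallel.  A computation turns the equation for [h] into their
    flatness ([graph_connection_flat]).  By Frobenius' theorem for linear
    systems ([pfaffian_local]) there are a parallel frame [W], [d_j W = W C j],
    with [W^T W = H] at the base point, and functions [u] with
    [d_j u = W e_j].  The difference [W^T W - H] solves a homogeneous linear
    system and vanishes at the base point, hence vanishes identically, and
    [(h, u)] is an isometric immersion ([graph_local_isometry]).

    Frobenius' theorem is proved by solving the system along each ray from the
    base point, which is a linear ordinary differential equation.  If [y_v] is
    the solution along [v], flatness says that [t |-> y_v (1 + t A_h)] solves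
    the equation along [v + h] up to an error [O(|h|^2)] ([step_bound]).
    Gronwall's inequality then shows that [v |-> y_v 1] is differentiable with
    the prescribed derivatives.  Smoothness follows from the system itself. *)

(** * Smooth functions of several variables *)

Section Differentiability.
Context {R : realType} {V W : normedModType R}.
Implicit Types f g : V -> W.

(** Differentials are handled through explicit bounds, because the error terms
    below come from estimates of differential equations and not from rules of
    calculus. *)
Lemma differentiable_of_estimate f x (df : {linear V -> W}) :
  continuous df ->
  (forall e, 0 < e -> \forall h \near 0, `|f (x + h) - f x - df h| <= e * `|h|) ->
  differentiable f x /\ 'd f x = df :> (V -> W).
Proof.
move=> cdf est.
have loc : f \o shift x = cst (f x) + df +o_ (0 : V) id.
  apply/eqaddoP => e e0; near=> h.
  rewrite -[X in `|X|]/(f (h + x) - (f x + df h)) opprD addrA [h + x]addrC.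
  by near: h; exact: est.
have eqd := diff_unique cdf loc; split => //.
apply/diff_locallyP; rewrite eqd; split => //.
Unshelve. all: by end_near. Qed.

Lemma differentiable_estimate f x : differentiable f x ->
  forall e, 0 < e ->
    \forall h \near 0, `|f (x + h) - f x - 'd f x h| <= e * `|h|.
Proof.
move=> /diff_locallyP[_ /eqaddoP est] e e0.
have := est _ e0; apply: filterS => h /=.
rewrite -[X in `|X|]/(f (h + x) - (f x + 'd f x h)) opprD addrA [h + x]addrC.
by [].
Qed.

Lemma near_eq_differentiable f g x :
  (\near x, f x = g x) -> differentiable f x -> differentiable g x.
Proof.
move=> fg df.
have cd : continuous ('d f x) by exact: diff_continuous.
suff est : forall e, 0 < e ->
    \forall h \near 0, `|g (x + h) - g x - 'd f x h| <= e * `|h|.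
  by have [] := differentiable_of_estimate cd est.
move=> e e0.
have fg0 : \forall h \near (0 : V), f (x + h) = g (x + h).
  have := fg; rewrite (near_shift 0 x) /=; apply: filterS => h.
  by rewrite subr0 addrC.
rewrite -(nbhs_singleton fg).
near=> h.
have <- : f (x + h) = g (x + h) by near: h.
by near: h; exact: differentiable_estimate.
Unshelve. all: by end_near. Qed.

End Differentiability.

Section Smooth.
Context {R : realType} {n : nat}.
Local Notation E := 'rV[R]_n.
Implicit Types (U : set E) (k : nat).

Lemma smooth_differentiable (W : normedModType R) U (f : E -> W) x :
  smooth_on U f -> U x -> differentiable f x.
Proof. by move=> /(_ 1%N) [+ _]; apply. Qed.

Lemma smooth_partial (W : normedModType R) U (f : E -> W) i :
  smooth_on U f -> smooth_on U (partial i f).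
Proof. by move=> sf k; have [_ pf] := sf k.+1; exact: pf. Qed.

Lemma Ck_onW (W : normedModType R) k U (f : E -> W) :
  Ck_on k.+1 U f -> Ck_on k U f.
Proof.
elim: k f => [|k IH] f [df pf].
  by move=> x /[!inE] Ux; exact: (differentiable_continuous (df _ Ux)).
by split => // i; exact: IH.
Qed.

(** The values off [U] do not matter because [U] is open: the partial
    derivatives at a point of [U] only depend on the germ of the function. *)
Lemma Ck_on_ext (W : normedModType R) k U (f g : E -> W) : open U ->
  (forall x, U x -> f x = g x) -> Ck_on k U f -> Ck_on k U g.
Proof.
move=> oU; elim: k f g => [|k IH] f g fg.
  move=> cf x Ux; have := cf x Ux; move: Ux => /[!inE] Ux.
  rewrite /prop_for /continuous_at -fg//; apply: cvg_trans.
  apply: (near_eq_cvg (F := nbhs x)).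
  have Unx : nbhs x U by exact: open_nbhs_nbhs.
  by apply: (filterS (F := nbhs x) _ Unx) => y /fg.
have fgn x : U x -> \near x, f x = g x.
  move=> Ux; have Unx : nbhs x U by exact: open_nbhs_nbhs.
  exact: (filterS (F := nbhs x) _ Unx).
move=> [df pf]; split => [x Ux|i].
  exact: near_eq_differentiable (fgn x Ux) (df x Ux).
by apply: IH (pf i) => x Ux; exact: near_eq_derive (fgn x Ux).
Qed.

Lemma smooth_ext (W : normedModType R) U (f g : E -> W) : open U ->
  (forall x, U x -> f x = g x) -> smooth_on U f -> smooth_on U g.
Proof. by move=> oU fg sf k; exact: Ck_on_ext (sf k). Qed.

Lemma Ck_on_sub (W : normedModType R) k U U' (f : E -> W) :
  U' `<=` U -> Ck_on k U f -> Ck_on k U' f.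
Proof.
move=> sU; elim: k f => [|k IH] f.
  by move=> cf x /[!inE] Ux; apply: cf; rewrite inE; exact: sU.
by move=> [df pf]; split => [x /sU/df//|i]; exact: IH (pf i).
Qed.

Lemma smooth_sub (W : normedModType R) U U' (f : E -> W) :
  U' `<=` U -> smooth_on U f -> smooth_on U' f.
Proof. by move=> sU sf k; exact: Ck_on_sub (sf k). Qed.

Lemma Ck_on_cst (W : normedModType R) k U (a : W) : Ck_on k U (cst a : E -> W).
Proof.
elim: k a => [|k IH] a; first by move=> x _; exact: (@cst_continuous _ _ a x).
split=> [x _|i]; first exact: differentiable_cst.
have -> : partial i (cst a : E -> W) = cst 0.
  by apply/funext => x; rewrite /partial derive_cst.
exact: IH.
Qed.

Lemma smooth_cst (W : normedModType R) U (a : W) : smooth_on U (cst a : E -> W).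
Proof. by move=> k; exact: Ck_on_cst. Qed.

Lemma partialD (f g : E -> R) i x : differentiable f x -> differentiable g x ->
  partial i (fun y => f y + g y) x = partial i f x + partial i g x.
Proof. by move=> df dg; apply: deriveD; exact: diff_derivable. Qed.

Lemma partialN (f : E -> R) i x : differentiable f x ->
  partial i (fun y => - f y) x = - partial i f x.
Proof. by move=> df; apply: deriveN; exact: diff_derivable. Qed.

Lemma partialM (f g : E -> R) i x : differentiable f x -> differentiable g x ->
  partial i (fun y => f y * g y) x = partial i f x * g x + f x * partial i g x.
Proof.
move=> df dg; rewrite [LHS](deriveM (diff_derivable df) (diff_derivable dg)).
by rewrite addrC; congr (_ + _); rewrite mulrC.
Qed.

Lemma partial_sum p (f : 'I_p -> E -> R) i x :
  (forall j, differentiable (f j) x) ->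
  partial i (fun y => \sum_j f j y) x = \sum_j partial i (f j) x.
Proof.
move=> df; rewrite /partial -derive_sum => [|j]; last exact: diff_derivable.
by congr ('D_ _ _ _); apply/funext => y; rewrite functions.fct_sumE.
Qed.

Lemma differentiable_bigsum p (f : 'I_p -> E -> R) x :
  (forall j, differentiable (f j) x) ->
  differentiable (fun y => \sum_j f j y) x.
Proof.
move=> df; have := differentiable_sum df.
suff -> : (fun y => \sum_j f j y) = \sum_j f j by [].
by apply/funext => y; rewrite functions.fct_sumE.
Qed.

Lemma Ck_onD k U (f g : E -> R) : open U -> Ck_on k U f -> Ck_on k U g ->
  Ck_on k U (fun x => f x + g x).
Proof.
move=> oU; elim: k f g => [|k IH] f g.
  by move=> cf cg x Ux; exact: (cvgD (cf x Ux) (cg x Ux)).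
move=> [df pf] [dg pg]; split => [x Ux|i].
  by apply: differentiableD; [exact: df|exact: dg].
apply: Ck_on_ext (IH _ _ (pf i) (pg i)) => // x Ux.
by rewrite partialD; [|exact: df|exact: dg].
Qed.

Lemma Ck_onM k U (f g : E -> R) : open U -> Ck_on k U f -> Ck_on k U g ->
  Ck_on k U (fun x => f x * g x).
Proof.
move=> oU; elim: k f g => [|k IH] f g.
  by move=> cf cg x Ux; exact: (cvgM (cf x Ux) (cg x Ux)).
move=> kf kg; have [df pf] := kf; have [dg pg] := kg; split => [x Ux|i].
  by apply: differentiableM; [exact: df|exact: dg].
apply: (Ck_on_ext oU _ (Ck_onD oU (IH _ _ (pf i) (Ck_onW kg))
  (IH _ _ (Ck_onW kf) (pg i)))) => x Ux.
by rewrite partialM; [|exact: df|exact: dg].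
Qed.

Lemma smoothD U (f g : E -> R) : open U -> smooth_on U f -> smooth_on U g ->
  smooth_on U (fun x => f x + g x).
Proof. by move=> oU sf sg k; exact: Ck_onD. Qed.

Lemma smoothM U (f g : E -> R) : open U -> smooth_on U f -> smooth_on U g ->
  smooth_on U (fun x => f x * g x).
Proof. by move=> oU sf sg k; exact: Ck_onM. Qed.

Lemma smoothN U (f : E -> R) : open U -> smooth_on U f ->
  smooth_on U (fun x => - f x).
Proof.
move=> oU sf; apply: smooth_ext (smoothM oU (smooth_cst U (-1 : R)) sf) => // x _.
by rewrite /= mulN1r.
Qed.

Lemma smoothB U (f g : E -> R) : open U -> smooth_on U f -> smooth_on U g ->
  smooth_on U (fun x => f x - g x).
Proof. by move=> oU sf sg; apply: smoothD => //; exact: smoothN. Qed.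

Lemma Ck_on_sum (I : finType) (P : pred I) k U (f : I -> E -> R) : open U ->
  (forall j, P j -> Ck_on k U (f j)) ->
  Ck_on k U (fun x => \sum_(j | P j) f j x).
Proof.
move=> oU sf; rewrite /index_enum; elim: (Finite.enum _) => [|j s IH].
  by apply: Ck_on_ext (Ck_on_cst k U (0 : R)) => // x _; rewrite big_nil.
case: (boolP (P j)) => Pj.
  apply: Ck_on_ext (Ck_onD oU (sf j Pj) IH) => // x _.
  by rewrite big_cons Pj.
by apply: Ck_on_ext IH => // x _; rewrite big_cons (negPf Pj).
Qed.

Lemma smooth_sum (I : finType) (P : pred I) U (f : I -> E -> R) : open U ->
  (forall j, P j -> smooth_on U (f j)) ->
  smooth_on U (fun x => \sum_(j | P j) f j x).
Proof. by move=> oU sf k; apply: Ck_on_sum => // j Pj; exact: sf. Qed.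

Lemma smooth_prod (I : finType) (P : pred I) U (f : I -> E -> R) : open U ->
  (forall j, P j -> smooth_on U (f j)) ->
  smooth_on U (fun x => \prod_(j | P j) f j x).
Proof.
move=> oU sf; rewrite /index_enum; elim: (Finite.enum _) => [|j s IH].
  by apply: smooth_ext (smooth_cst U (1 : R)) => // x _; rewrite big_nil.
case: (boolP (P j)) => Pj.
  apply: smooth_ext (smoothM oU (sf j Pj) IH) => // x _.
  by rewrite big_cons Pj.
by apply: smooth_ext IH => // x _; rewrite big_cons (negPf Pj).
Qed.

Lemma partialV (f : E -> R) i x : differentiable f x -> f x != 0 ->
  partial i (fun y => (f y)^-1) x = - partial i f x * ((f x)^-1 * (f x)^-1).
Proof.
move=> df fx; have := deriveV fx (diff_derivable (v := delta_mx 0 i) df).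
rewrite /partial => ->.
rewrite -[LHS]/(- (f x) ^- 2 * _) mulNr mulNr mulrC; congr (- (_ * _)).
by rewrite expr2 invfM.
Qed.

(** The derivative of [1 / f] is [- f'] times the square of [1 / f], so that one
    more order of smoothness is gained at each step of an induction. *)
Lemma smoothV U (f : E -> R) : open U -> (forall x, U x -> f x != 0) ->
  smooth_on U f -> smooth_on U (fun x => (f x)^-1).
Proof.
move=> oU f0 sf; elim=> [|k IH].
  move=> x Ux; apply: (cvgV _ (sf 0%N x Ux)).
  by apply: f0; move: Ux; rewrite inE.
split=> [x Ux|i].
  by apply: differentiableV; [exact: smooth_differentiable|exact: f0].
have spf := smoothN oU (smooth_partial i sf).
apply: (Ck_on_ext oU _ (Ck_onM oU (spf k) (Ck_onM oU IH IH))) => x Ux.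
by rewrite partialV //; [exact: smooth_differentiable|exact: f0].
Qed.

End Smooth.

(** * The chain rule and the symmetry of second derivatives *)

Section MatrixNorm.
Context {R : realType}.

Lemma mx_norm_le p q (A : 'M[R]_(p, q)) (c : R) : 0 <= c ->
  (forall i j, `|A i j| <= c) -> `|A| <= c.
Proof.
move=> c0 Ac; rewrite [leLHS]/Num.Def.normr /= mx_normrE.
by apply: bigmax_le => // -[i j] _; exact: Ac.
Qed.

Lemma mx_entry_le p q (A : 'M[R]_(p, q)) i j : `|A i j| <= `|A|.
Proof.
rewrite [leRHS]/Num.Def.normr /= mx_normrE.
exact: (le_bigmax _ (fun ij : 'I_p * 'I_q => `|A ij.1 ij.2|) (i, j)).
Qed.

Lemma mx_norm_mul p q r (A : 'M[R]_(p, q)) (B : 'M[R]_(q, r)) :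
  `|A *m B| <= q%:R * (`|A| * `|B|).
Proof.
apply: mx_norm_le => [|i j]; first by rewrite !mulr_ge0.
rewrite mxE (le_trans (ler_norm_sum _ _ _))//.
rewrite (@le_trans _ _ (\sum_(k < q) `|A| * `|B|)) //.
  by apply: ler_sum => k _; rewrite normrM ler_pM // mx_entry_le.
by rewrite sumr_const card_ord mulr_natl.
Qed.

Lemma norm_delta_le1 p q i j : `|delta_mx i j : 'M[R]_(p, q)| <= 1.
Proof.
apply: mx_norm_le => // i' j'; rewrite mxE.
by case: (_ && _); rewrite ?normr1 ?normr0.
Qed.

End MatrixNorm.

Section Lines.
Context {R : realType} {n : nat}.
Local Notation E := 'rV[R]_n.
Implicit Types (U : set E).

Lemma is_derive_line (W : normedModType R) (f : E -> W) (x v : E) (t : R) :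
  differentiable f (x + t *: v) ->
  is_derive t 1 (fun s => f (x + s *: v)) ('D_v f (x + t *: v)).
Proof.
move=> df; have dfv := diff_derivable (v := v) df.
have E1 : (fun h : R => h^-1 *: (f (x + (h *: (1 : R) + t) *: v)
    - f (x + t *: v))) =
    (fun h : R => h^-1 *: (f (h *: v + (x + t *: v)) - f (x + t *: v))).
  apply/funext => h; congr (_ *: (f _ - _)).
  by rewrite scalerDl -[h *: 1]/(h * 1) mulr1 addrCA.
apply: DeriveDef.
  by rewrite /derivable; move: dfv; rewrite /derivable -E1.
by rewrite /derive -E1.
Qed.

Lemma mvt_line (f : E -> R) (x v : E) (t : R) : 0 < t ->
  (forall s, 0 <= s <= t -> differentiable f (x + s *: v)) ->
  exists2 s, 0 < s < t & f (x + t *: v) - f x = t * 'D_v f (x + s *: v).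
Proof.
move=> t0 df.
have D s : 0 <= s <= t ->
    is_derive s 1 (fun s => f (x + s *: v)) ('D_v f (x + s *: v)).
  by move=> st; apply: is_derive_line; exact: df.
have [||s st] := @MVT R (fun s => f (x + s *: v))
  (fun s => 'D_v f (x + s *: v)) 0 t t0.
- by move=> s; rewrite in_itv /= => /andP[s0 st]; apply: D; rewrite !ltW.
- apply: derivable_within_continuous => s; rewrite in_itv /= => st.
  by have [] := D s st.
rewrite scale0r addr0 subr0 mulrC => ->; exists s => //.
Qed.

Lemma differential_rV m (W : normedModType R) (f : 'rV[R]_m -> W) x v :
  'd f x v = \sum_j v 0 j *: 'd f x (delta_mx 0 j).
Proof.
rewrite [in LHS](row_sum_delta v) linear_sum /=.
by apply: eq_bigr => j _; rewrite linearZ.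
Qed.

Lemma derive_rV (f : E -> R) (x v : E) : differentiable f x ->
  'D_v f x = \sum_j v 0 j * partial j f x.
Proof.
move=> df; rewrite deriveE // differential_rV.
by apply: eq_bigr => j _; rewrite /partial deriveE.
Qed.

Lemma partial_entry p q (F : E -> 'M[R]_(p, q)) i a b x : differentiable F x ->
  partial i (fun y => F y a b) x = (partial i F x) a b.
Proof.
by move=> dF; rewrite /partial derive_mx ?mxE //; exact: diff_derivable.
Qed.

Lemma differentiable_entry p q (F : E -> 'M[R]_(p, q)) a b x :
  differentiable F x -> differentiable (fun y => F y a b) x.
Proof.
move=> dF; apply: (@differentiable_comp _ _ _ _ F (fun M : 'M[R]_(p, q) => M a b)).
  exact: dF.
exact: differentiable_coord.
Qed.

Lemma Ck_on_entry p q k U (F : E -> 'M[R]_(p, q)) a b : open U ->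
  Ck_on k U F -> Ck_on k U (fun y => F y a b).
Proof.
move=> oU; elim: k F => [|k IH] F.
  move=> cF x Ux; have cFx := cF x Ux.
  exact: (continuous_comp cFx (@coord_continuous _ _ _ a b _)).
move=> [dF pF]; split => [x Ux|i].
  by apply: differentiable_entry; exact: dF.
apply: (Ck_on_ext oU _ (IH _ (pF i))) => x Ux.
by rewrite partial_entry //; exact: dF.
Qed.

Lemma smooth_entry p q U (F : E -> 'M[R]_(p, q)) a b : open U ->
  smooth_on U F -> smooth_on U (fun y => F y a b).
Proof. by move=> oU sF k; exact: Ck_on_entry. Qed.

Lemma jacobianE m (f : E -> 'rV[R]_m) x i j : differentiable f x ->
  'J f x i j = partial i (fun y => f y 0 j) x.
Proof.
move=> df; rewrite partial_entry // /partial deriveE //.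
by rewrite /jacobian /lin1_mx mxE.
Qed.

Lemma partial_comp m (phi : E -> 'rV[R]_m) (f : 'rV[R]_m -> R) i x :
  differentiable phi x -> differentiable f (phi x) ->
  partial i (f \o phi) x =
    \sum_j partial j f (phi x) * partial i (fun y => phi y 0 j) x.
Proof.
move=> dphi df.
have -> : partial i (f \o phi) x = 'd f (phi x) ('d phi x (delta_mx 0 i)).
  rewrite [LHS]deriveE; last exact: (differentiable_comp dphi df).
  by rewrite (diff_comp dphi df).
rewrite (differential_rV f); apply: eq_bigr => j _.
rewrite (partial_entry i 0 j dphi) /partial (deriveE _ df) (deriveE _ dphi).
exact: mulrC.
Qed.

(** Only the outer function loses a derivative in the induction: the chain rule
    writes the partial derivatives of a composite as sums of products of
    composites of lower order and derivatives of the smooth inner function. *)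
Lemma Ck_on_comp m k U (V : set 'rV[R]_m) (phi : E -> 'rV[R]_m)
    (f : 'rV[R]_m -> R) : open U -> (forall x, U x -> V (phi x)) ->
  smooth_on U phi -> Ck_on k V f -> Ck_on k U (f \o phi).
Proof.
move=> oU UV sphi; elim: k f => [|k IH] f.
  move=> cf x Ux; apply: continuous_comp; first exact: (sphi 0%N x Ux).
  by apply: cf; move: Ux; rewrite !inE => /UV.
move=> [df pf]; split=> [x Ux|i].
  apply: differentiable_comp; first exact: smooth_differentiable Ux.
  by apply: df; exact: UV.
have C : Ck_on k U (fun x => \sum_j (partial j f \o phi) x
    * partial i (fun y => phi y 0 j) x).
  apply: Ck_on_sum => // j _; apply: Ck_onM => //; first exact: IH (pf j).
  by apply: smooth_partial; exact: smooth_entry.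
apply: Ck_on_ext C => // x Ux; rewrite partial_comp //.
  exact: smooth_differentiable Ux.
by apply: df; exact: UV.
Qed.

Lemma smooth_comp m U (V : set 'rV[R]_m) (phi : E -> 'rV[R]_m)
    (f : 'rV[R]_m -> R) : open U -> (forall x, U x -> V (phi x)) ->
  smooth_on U phi -> smooth_on V f -> smooth_on U (f \o phi).
Proof. by move=> oU UV sphi sf k; exact: (Ck_on_comp oU UV). Qed.

Lemma open_subball_at U x : open U -> U x ->
  exists2 d : R, 0 < d & ball x d `<=` U.
Proof.
move=> oU Ux; have := open_nbhs_nbhs (conj oU Ux).
by rewrite -nbhs_ballE => -[d /= d0 dU]; exists d.
Qed.

Lemma smooth_ball (W : normedModType R) U (f : E -> W) x (e : R) :
  smooth_on U f -> U x -> 0 < e ->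
  exists2 d : R, 0 < d & forall z, ball x d z -> `|f x - f z| < e.
Proof.
move=> sf Ux e0; have := sf 0%N x (mem_set Ux).
move=> /cvgrPdist_lt/(_ _ e0).
by rewrite -nbhs_ballE => -[d /= d0 dP]; exists d.
Qed.

(** The mean value theorem is applied twice to the symmetric second difference of
    [f], once in each direction.  Exchanging [i] and [j] does not change the
    left-hand side, whence the equality of the mixed derivatives. *)
Lemma second_difference U (f : E -> R) x i j (d t : R) :
  ball x d `<=` U -> smooth_on U f -> 0 < t -> t + t < d ->
  exists2 z, ball x d z &
    f (x + t *: delta_mx 0 j + t *: delta_mx 0 i)
    - f (x + t *: delta_mx 0 i)
    - (f (x + t *: delta_mx 0 j) - f x) = t * (t * partial j (partial i f) z).
Proof.
move=> bU sf t0 ttd.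
pose ei : E := delta_mx 0 i; pose ej : E := delta_mx 0 j.
have inb s r : 0 <= s <= t -> 0 <= r <= t -> ball x d (x + s *: ei + r *: ej).
  move=> /andP[s0 st] /andP[r0 rt].
  rewrite -ball_normE /ball_ /= -addrA opprD addrA subrr add0r normrN.
  apply: le_lt_trans ttd; rewrite (le_trans (ler_normD _ _))// lerD //.
    rewrite normrZ ger0_norm //; apply: le_trans st.
    by rewrite ler_piMr // norm_delta_le1.
  rewrite normrZ ger0_norm //; apply: le_trans rt.
  by rewrite ler_piMr // norm_delta_le1.
have t0t : 0 <= t <= t by rewrite (ltW t0) lexx.
have O0t : 0 <= 0 :> R by [].
have zt : 0 <= (0 : R) <= t by rewrite lexx ltW.
pose g (s : R) := f (x + t *: ej + s *: ei) - f (x + s *: ei).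
have Dg s : 0 <= s <= t -> is_derive s 1 g
    (partial i f (x + t *: ej + s *: ei) - partial i f (x + s *: ei)).
  move=> st; apply: is_deriveB; apply: is_derive_line.
    apply: (smooth_differentiable sf); apply: bU; rewrite addrAC.
    exact: inb.
  apply: (smooth_differentiable sf); apply: bU.
  by rewrite -[x + _]addr0 -(scale0r ej); exact: inb st zt.
have oc s : s \in `]0, t[%R -> 0 <= s <= t.
  by rewrite in_itv /= => /andP[? ?]; rewrite !ltW.
have [s /oc st gE] : exists2 c, c \in `]0, t[%R & g t - g 0 =
    (partial i f (x + t *: ej + c *: ei) - partial i f (x + c *: ei)) * (t - 0).
  apply: MVT => // [s /oc|]; first exact: Dg.
  apply: derivable_within_continuous => s; rewrite in_itv /= => st.
  by have [] := Dg s st.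
have [r|r rt fE] := @mvt_line (partial i f) (x + s *: ei) ej t t0.
  move=> rt; apply: (smooth_differentiable (smooth_partial i sf)).
  by apply: bU; exact: inb.
exists (x + s *: ei + r *: ej).
  by apply: inb => //; case/andP: rt => ? ?; rewrite !ltW.
move: gE; rewrite /g !scale0r !addr0 subr0 => ->.
by rewrite addrAC fE mulrC.
Qed.

(** Schwarz' theorem.  Both mixed derivatives are values, at two points
    close to [x], of continuous functions that agree there. *)
Lemma partial_comm U (f : E -> R) x i j : open U -> smooth_on U f -> U x ->
  partial j (partial i f) x = partial i (partial j f) x.
Proof.
move=> oU sf Ux; apply/eqP; rewrite -subr_eq0 -normr_le0.
apply/ler_addgt0Pr => e e0; rewrite add0r.
have e20 : 0 < e / 2 by rewrite divr_gt0.
have [d1 d10 c1] := smooth_ball (smooth_partial j (smooth_partial i sf)) Ux e20.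
have [d2 d20 c2] := smooth_ball (smooth_partial i (smooth_partial j sf)) Ux e20.
have [d3 d30 c3] := open_subball_at oU Ux.
have [d d0 [dd1 dd2 dd3]] : exists2 d, 0 < d & [/\ d <= d1, d <= d2 & d <= d3].
  exists (Num.min d1 (Num.min d2 d3)); first by rewrite !lt_min d10 d20.
  by rewrite !ge_min !lexx !orbT.
have dP z : ball x d z -> U z /\
    `|partial j (partial i f) x - partial j (partial i f) z| < e / 2 /\
    `|partial i (partial j f) x - partial i (partial j f) z| < e / 2.
  move=> bz; split; first by apply: c3; exact: le_ball dd3 _ bz.
  by split; [apply: c1; exact: le_ball dd1 _ bz|apply: c2; exact: le_ball dd2 _ bz].
have bU : ball x d `<=` U by move=> z /dP[].
have [t t0 td] : exists2 t, 0 < t & t + t < d.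
  by exists (d / 3); [rewrite divr_gt0|lra].
have [z /dP[_ [z1 z2]] zE] := second_difference i j bU sf t0 td.
have [w /dP[_ [w1 w2]] wE] := second_difference j i bU sf t0 td.
have zw : partial j (partial i f) z = partial i (partial j f) w.
  apply: (mulfI (lt0r_neq0 t0)); apply: (mulfI (lt0r_neq0 t0)).
  apply: etrans (esym zE) _; apply: etrans wE.
  rewrite (_ : x + t *: delta_mx 0 j + t *: delta_mx 0 i =
    x + t *: delta_mx 0 i + t *: delta_mx 0 j); last exact: addrAC.
  by rewrite !opprB addrACA [RHS]addrACA [- _ - _]addrC.
move: z1 w2; rewrite zw => z1 w2.
have w2' := w2; rewrite distrC in w2'.
apply: le_trans (ler_distD (partial i (partial j f) w) _ _) _.
by apply: ltW; apply: lt_le_trans (ltrD z1 w2') _; rewrite -splitr.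
Qed.

End Lines.

(** The derivative of a matrix field is sealed: otherwise the comparison of
    second derivatives of matrix products unfolds them down to limits. *)
HB.lock Definition dmx (R : realType) (n p q : nat) (j : 'I_n)
    (F : 'rV[R]_n -> 'M[R]_(p, q)) (x : 'rV[R]_n) : 'M[R]_(p, q) :=
  \matrix_(a, b) partial j (fun y => F y a b) x.

Section MatrixFields.
Context {R : realType} {n : nat}.
Local Notation E := 'rV[R]_n.
Implicit Types (U : set E).

(** Differentiability and smoothness of matrix fields are taken entry by entry, so
    that the rules of calculus for products reduce to those of real functions. *)
Definition mxdiff p q (F : E -> 'M[R]_(p, q)) x :=
  forall a b, differentiable (fun y => F y a b) x.

Definition mxsmooth p q U (F : E -> 'M[R]_(p, q)) :=
  forall a b, smooth_on U (fun y => F y a b).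

Lemma dmxE p q j (F : E -> 'M[R]_(p, q)) x a b :
  dmx j F x a b = partial j (fun y => F y a b) x.
Proof. by rewrite dmx.unlock mxE. Qed.

Lemma mxsmooth_diff p q U (F : E -> 'M[R]_(p, q)) x :
  mxsmooth U F -> U x -> mxdiff F x.
Proof. by move=> sF Ux a b; exact: smooth_differentiable (sF a b) Ux. Qed.

Lemma smooth_mxsmooth p q U (F : E -> 'M[R]_(p, q)) : open U ->
  smooth_on U F -> mxsmooth U F.
Proof. by move=> oU sF a b; exact: smooth_entry. Qed.

Lemma mxsmooth_sub p q U U' (F : E -> 'M[R]_(p, q)) :
  U' `<=` U -> mxsmooth U F -> mxsmooth U' F.
Proof. by move=> sU sF a b; exact: smooth_sub (sF a b). Qed.

Lemma mxsmooth_ext p q U (F G : E -> 'M[R]_(p, q)) : open U ->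
  (forall x, U x -> F x = G x) -> mxsmooth U F -> mxsmooth U G.
Proof.
by move=> oU FG sF a b; apply: smooth_ext (sF a b) => // x Ux; rewrite FG.
Qed.

Lemma mxsmooth_mx p q U (f : 'I_p -> 'I_q -> E -> R) : open U ->
  (forall a b, smooth_on U (f a b)) -> mxsmooth U (fun x => \matrix_(a, b) f a b x).
Proof.
by move=> oU sf a b; apply: smooth_ext (sf a b) => // x _; rewrite mxE.
Qed.

Lemma mxsmooth_dmx p q U j (F : E -> 'M[R]_(p, q)) : open U ->
  mxsmooth U F -> mxsmooth U (dmx j F).
Proof.
move=> oU sF a b; apply: smooth_ext (smooth_partial j (sF a b)) => // x _.
by rewrite dmxE.
Qed.

Lemma mxsmoothB p q U (F G : E -> 'M[R]_(p, q)) : open U ->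
  mxsmooth U F -> mxsmooth U G -> mxsmooth U (fun x => F x - G x).
Proof.
move=> oU sF sG a b.
by apply: smooth_ext (smoothB oU (sF a b) (sG a b)) => // x _; rewrite !mxE.
Qed.

Lemma mxsmoothZ p q U (c : E -> R) (F : E -> 'M[R]_(p, q)) : open U ->
  smooth_on U c -> mxsmooth U F -> mxsmooth U (fun x => c x *: F x).
Proof.
move=> oU sc sF a b.
by apply: smooth_ext (smoothM oU sc (sF a b)) => // x _; rewrite mxE.
Qed.

Lemma mxsmoothM p q r U (F : E -> 'M[R]_(p, q)) (G : E -> 'M[R]_(q, r)) :
  open U -> mxsmooth U F -> mxsmooth U G -> mxsmooth U (fun x => F x *m G x).
Proof.
move=> oU sF sG a b.
have s : smooth_on U (fun x => \sum_k F x a k * G x k b).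
  by apply: smooth_sum => // k _; exact: smoothM.
by apply: smooth_ext s => // x _; rewrite mxE.
Qed.

Lemma mxsmoothT p q U (F : E -> 'M[R]_(p, q)) : open U ->
  mxsmooth U F -> mxsmooth U (fun x => (F x)^T).
Proof.
by move=> oU sF a b; apply: smooth_ext (sF b a) => // x _; rewrite mxE.
Qed.

Lemma smooth_det p U (F : E -> 'M[R]_p) : open U ->
  mxsmooth U F -> smooth_on U (fun x => \det (F x)).
Proof.
move=> oU sF; apply: smooth_sum => // s _; apply: smoothM => //.
  exact: smooth_cst.
exact: smooth_prod.
Qed.

(** Cramer's rule: the inverse is a polynomial in the entries divided by the
    determinant. *)
Lemma mxsmooth_inv p U (F : E -> 'M[R]_p) : open U ->
  mxsmooth U F -> (forall x, U x -> F x \in unitmx) ->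
  mxsmooth U (fun x => invmx (F x)).
Proof.
move=> oU sF uF.
have s : mxsmooth U (fun x => (\det (F x))^-1 *: \adj (F x)).
  apply: mxsmoothZ => //.
    apply: smoothV; [by []| |exact: smooth_det].
    by move=> x /uF; rewrite unitmxE unitfE.
  move=> a b; have sd : mxsmooth U (fun x => row' b (col' a (F x))).
    by move=> c d; apply: smooth_ext (sF (lift b c) (lift a d)) => // x _; rewrite !mxE.
  have sc := smoothM oU (smooth_cst U ((-1) ^+ (b + a) : R)) (smooth_det oU sd).
  by apply: smooth_ext sc => // x _; rewrite mxE.
by apply: mxsmooth_ext s => // x Ux; rewrite /invmx uF.
Qed.

Lemma dmx_ext p q j U (F G : E -> 'M[R]_(p, q)) x : open U -> U x ->
  (forall y, U y -> F y = G y) -> dmx j F x = dmx j G x.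
Proof.
move=> oU Ux FG; apply/matrixP => a b; rewrite !dmxE; apply: near_eq_derive.
have Unx : nbhs x U by exact: open_nbhs_nbhs.
by apply: (filterS (F := nbhs x) _ Unx) => y /FG ->.
Qed.

Lemma dmxD p q j (F G : E -> 'M[R]_(p, q)) x : mxdiff F x -> mxdiff G x ->
  dmx j (fun y => F y + G y) x = dmx j F x + dmx j G x.
Proof.
move=> dF dG; apply/matrixP => a b; rewrite dmxE mxE !dmxE -partialD //.
by congr partial; apply/funext => y; rewrite mxE.
Qed.

Lemma dmxN p q j (F : E -> 'M[R]_(p, q)) x : mxdiff F x ->
  dmx j (fun y => - F y) x = - dmx j F x.
Proof.
move=> dF; apply/matrixP => a b; rewrite dmxE mxE dmxE -partialN //.
by congr partial; apply/funext => y; rewrite mxE.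
Qed.

Lemma mxdiffN p q (F : E -> 'M[R]_(p, q)) x : mxdiff F x ->
  mxdiff (fun y => - F y) x.
Proof.
move=> dF a b; have := differentiableN (dF a b).
by congr (differentiable _ _); apply/funext => y; rewrite mxE.
Qed.

Lemma dmxB p q j (F G : E -> 'M[R]_(p, q)) x : mxdiff F x -> mxdiff G x ->
  dmx j (fun y => F y - G y) x = dmx j F x - dmx j G x.
Proof.
by move=> dF dG; rewrite dmxD ?dmxN //; exact: mxdiffN.
Qed.

Lemma dmxT p q j (F : E -> 'M[R]_(p, q)) x :
  dmx j (fun y => (F y)^T) x = (dmx j F x)^T.
Proof.
apply/matrixP => a b; rewrite mxE !dmxE.
by congr partial; apply/funext => y; rewrite mxE.
Qed.

Lemma dmxZ p q j (c : E -> R) (F : E -> 'M[R]_(p, q)) x :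
  differentiable c x -> mxdiff F x ->
  dmx j (fun y => c y *: F y) x = partial j c x *: F x + c x *: dmx j F x.
Proof.
move=> dc dF; apply/matrixP => a b; rewrite dmxE !mxE dmxE -partialM //.
by congr partial; apply/funext => y; rewrite mxE.
Qed.

Lemma dmxM p q r j (F : E -> 'M[R]_(p, q)) (G : E -> 'M[R]_(q, r)) x :
  mxdiff F x -> mxdiff G x ->
  dmx j (fun y => F y *m G y) x = dmx j F x *m G x + F x *m dmx j G x.
Proof.
move=> dF dG; apply/matrixP => a b; rewrite dmxE !mxE.
have -> : (fun y => (F y *m G y) a b) = (fun y => \sum_k F y a k * G y k b).
  by apply/funext => y; rewrite mxE.
rewrite partial_sum => [|k]; last exact: differentiableM.
by rewrite -big_split; apply: eq_bigr => k _; rewrite /= !dmxE partialM.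
Qed.

Lemma dmx_comm p q U i j (F : E -> 'M[R]_(p, q)) x : open U ->
  mxsmooth U F -> U x -> dmx j (dmx i F) x = dmx i (dmx j F) x.
Proof.
move=> oU sF Ux; apply/matrixP => a b.
have H k l : dmx l (dmx k F) x a b = partial l (partial k (fun y => F y a b)) x.
  by rewrite [LHS]dmxE; congr partial; apply/funext => y; rewrite dmxE.
apply: etrans (H i j) _; apply: etrans (esym (H j i)).
exact: (partial_comm i j oU (sF a b) Ux).
Qed.

End MatrixFields.

(** * Linear ordinary differential equations *)

Section MatrixCurves.
Context {R : realType} {p q : nat}.
Implicit Types (y dy : R -> 'M[R]_(p, q)).

Definition mx_is_derive y (t : R) (dy : 'M[R]_(p, q)) :=
  forall a b, is_derive t 1 (fun s => y s a b) (dy a b).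

Lemma mx_continuous (T : topologicalType) (F : T -> 'M[R]_(p, q)) (t : T) :
  (forall a b, {for t, continuous (fun s => F s a b)}) ->
  {for t, continuous F}.
Proof.
move=> cF; apply/cvgrPdist_le => e e0.
have : \forall s \near t, forall ab : 'I_p * 'I_q,
    `|F t ab.1 ab.2 - F s ab.1 ab.2| <= e.
  by apply: filter_forall => -[a b]; have /cvgrPdist_le/(_ _ e0) := cF a b.
apply: filterS => s Fs; apply: mx_norm_le => [|a b]; first exact: ltW.
by rewrite !mxE; exact: (Fs (a, b)).
Qed.

Lemma mx_derive_continuous y t (A : 'M[R]_(p, q)) : mx_is_derive y t A -> {for t, continuous y}.
Proof.
move=> D; apply: mx_continuous => a b; apply: differentiable_continuous.
by apply/derivable1_diffP; have [] := D a b.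
Qed.

Lemma continuous_mx_entry (T : topologicalType) (F : T -> 'M[R]_(p, q)) t a b :
  {for t, continuous F} -> {for t, continuous (fun s => F s a b)}.
Proof.
by move=> cF; exact: (continuous_comp cF (@coord_continuous _ _ _ a b _)).
Qed.

(** For the maximum norm, the mean value inequality follows from the
    mean value theorem for each entry. *)
Lemma mx_mvt_le y dy (t c : R) : 0 <= t ->
  (forall s, 0 <= s <= t -> {for s, continuous y}) ->
  (forall s, 0 < s < t -> mx_is_derive y s (dy s)) -> 0 <= c ->
  (forall s, 0 < s < t -> `|dy s| <= c) -> `|y t - y 0| <= t * c.
Proof.
move=> t0 cy Dy c0 dyc; apply: mx_norm_le => [|a b]; first exact: mulr_ge0.
move: t0; rewrite le_eqVlt => /predU1P[<-|t0].
  by rewrite subrr mxE normr0 mul0r.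
rewrite !mxE.
have [s st E] : exists2 s, s \in `]0, t[%R & y t a b - y 0 a b = dy s a b * (t - 0).
  apply: (@MVT R (fun s => y s a b) (fun s => dy s a b)) => //.
    by move=> s; rewrite in_itv /= => st; exact: Dy.
  apply/continuous_in_subspaceT => s /[!inE] /=; rewrite in_itv /= => st.
  by apply: continuous_mx_entry; exact: cy.
rewrite E subr0 normrM (gtr0_norm t0) mulrC ler_wpM2l ?(ltW t0) //.
apply: le_trans (mx_entry_le _ _ _) _; apply: dyc.
by move: st; rewrite in_itv.
Qed.

(** The constant one half on an interval of length one makes the bound immediate:
    at a point [c] where [|y|] is largest, the mean value inequality gives
    [|y c| <= |y c| / 2 + e]. *)
Lemma gronwall_half y dy (e : R) : 0 <= e ->
  (forall s, 0 <= s <= 1 -> {for s, continuous y}) ->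
  (forall s, 0 < s < 1 -> mx_is_derive y s (dy s)) -> y 0 = 0 ->
  (forall s, 0 < s < 1 -> `|dy s| <= 2^-1 * `|y s| + e) ->
  forall s, 0 <= s <= 1 -> `|y s| <= 2 * e.
Proof.
move=> e0 cy Dy y0 dye.
have [c c01 cmax] : exists2 c, c \in `[0, 1]%R &
    forall t, t \in `[0, 1]%R -> `|y t| <= `|y c|.
  apply: (@EVT_max R (fun s => `|y s|)) => //.
  apply/continuous_in_subspaceT => s /[!inE] /=; rewrite in_itv /= => st.
  exact: (cvg_norm (cy s st)).
have {c01}c01 : 0 <= c <= 1 by rewrite in_itv in c01.
have /andP[c0 c1] := c01.
have yc : `|y c| <= c * (2^-1 * `|y c| + e).
  rewrite -[X in `|X| <= _]subr0 -[X in _ - X]y0.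
  apply: (mx_mvt_le (dy := dy)) => //.
  - by move=> s /andP[s0 sc]; apply: cy; rewrite s0 (le_trans sc).
  - by move=> s /andP[s0 sc]; apply: Dy; rewrite s0 (lt_le_trans sc).
  - by rewrite addr_ge0 // mulr_ge0 // invr_ge0.
  move=> s /andP[s0 sc]; apply: le_trans (dye s _) _.
    by rewrite s0 (lt_le_trans sc).
  by rewrite lerD2r ler_pM2l ?invr_gt0 // cmax // in_itv /= (ltW s0) (ltW (lt_le_trans sc c1)).
have yc' : `|y c| <= 2^-1 * `|y c| + e.
  apply: le_trans yc _; by rewrite ler_piMl // addr_ge0 // mulr_ge0 // invr_ge0.
move=> s s01; apply: le_trans (cmax s _) _; first by rewrite in_itv.
move: `|y c| yc' => m; lra.
Qed.

End MatrixCurves.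

Lemma continuous_sum_at {R : realType} (T : topologicalType) (I : finType)
    (f : I -> T -> R) t : (forall i, {for t, continuous (f i)}) ->
  {for t, continuous (fun s => \sum_i f i s)}.
Proof.
move=> cf; rewrite /index_enum; elim: (Finite.enum _) => [|i s IH].
  have -> : (fun s => \sum_(i <- [::]) f i s) = cst 0.
    by apply/funext => s; rewrite big_nil.
  exact: cvg_cst.
have -> : (fun x => \sum_(j <- i :: s) f j x) =
    (fun x => f i x + \sum_(j <- s) f j x).
  by apply/funext => x; rewrite big_cons.
exact: (cvgD (cf i) IH).
Qed.

Lemma continuous_mulmx {R : realType} (T : topologicalType) p q r
    (F : T -> 'M[R]_(p, q)) (G : T -> 'M[R]_(q, r)) t :
  {for t, continuous F} -> {for t, continuous G} ->
  {for t, continuous (fun s => F s *m G s)}.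
Proof.
move=> cF cG; apply: mx_continuous => a b.
have -> : (fun s => (F s *m G s) a b) = (fun s => \sum_k F s a k * G s k b).
  by apply/funext => s; rewrite mxE.
apply: continuous_sum_at => k.
by apply: continuousM; exact: continuous_mx_entry.
Qed.

Section Primitive.
Context {R : realType}.
Local Notation mu := (@lebesgue_measure R).

(** The integral is taken from -1 and not from 0, so that 0 is an interior
    point of the domain: the primitive is then differentiable there,
    and in particular continuous on all of [0, 1]. *)
Definition primitive (f : R -> R) (t : R) : R :=
  (\int[mu]_(s in [set` `[(-1 : R), t]]) f s)%R
  - (\int[mu]_(s in [set` `[(-1 : R), 0]]) f s)%R.

Lemma primitive0 f : primitive f 0 = 0.
Proof. by rewrite /primitive subrr. Qed.

Lemma is_derive_primitive (f : R -> R) (t : R) : continuous f -> -1 < t ->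
  is_derive t 1 (primitive f) (f t).
Proof.
move=> cf t1.
have int : mu.-integrable `[-1, t + 1] (EFin \o f).
  apply: continuous_compact_integrable; first exact: segment_compact.
  by apply: continuous_subspaceT.
have tt1 : t < t + 1 by rewrite ltrDl.
have [D E] := continuous_FTC1_closed tt1 int t1 (cf t).
have -> : primitive f = (fun y => \int[mu]_(s in [set` `[(-1 : R), y]]) f s)%R
    - cst (\int[mu]_(s in [set` `[(-1 : R), 0]]) f s)%R by [].
rewrite -E derive1E -[X in is_derive _ _ _ X]subr0.
by apply: is_deriveB; exact: derivableP.
Qed.

End Primitive.

Section Clamp.
Context {R : realType}.

(** Composing with the retraction of the line onto [0, 1] turns curves on this
    segment into curves on the line, where continuity needs no
    restriction. *)
Definition clamp (t : R) : R := Num.max 0 (Num.min t 1).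

Lemma clamp01 t : 0 <= clamp t <= 1.
Proof. by rewrite /clamp le_max lexx /= ge_max ler01 ge_min lexx orbT. Qed.

Lemma clamp_id t : 0 <= t <= 1 -> clamp t = t.
Proof. by move=> /andP[t0 t1]; rewrite /clamp min_l // max_r. Qed.

Lemma clamp_continuous : continuous clamp.
Proof.
move=> t.
have c1 : {for t, continuous (fun s : R => Num.min s 1)}.
  by apply: (@continuous_min R R id (cst 1)); [exact: cvg_id|exact: cvg_cst].
by apply: (@continuous_max R R (cst 0) (fun s => Num.min s 1)); first exact: cvg_cst.
Qed.

End Clamp.

(** Picard's iteration for [y' = y B] on [0, 1].  The factor [N] in
    [beta_small] comes from the norm of a product of matrices for the maximum
    norm; the hypothesis makes the iteration a contraction of ratio one half on
    the whole segment, so that it converges there uniformly. *)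
Section LinearODE.
Context {R : realType} {p N : nat}.
Variables (B : R -> 'M[R]_N) (beta : R) (Y0 : 'M[R]_(p, N)).
Hypothesis cB : continuous B.
Hypothesis Bbeta : forall t, `|B t| <= beta.
Hypothesis beta_small : N%:R * beta <= 2^-1.

Let picard (y : R -> 'M[R]_(p, N)) (t : R) : 'M[R]_(p, N) :=
  \matrix_(a, b) (Y0 a b + primitive (fun s => (y s *m B s) a b) (clamp t)).

Let picard_derive y t : continuous y -> 0 < t < 1 ->
  mx_is_derive (picard y) t (y t *m B t).
Proof.
move=> cy t01 a b.
have t01' : -1 < t by case/andP: t01 => t0 _; rewrite (lt_trans _ t0) // ltrN10.
have cyB : continuous (fun s => (y s *m B s) a b).
  by move=> s; exact: (@continuous_mx_entry _ _ _ _ _ s a b (continuous_mulmx (cy s) (@cB s))).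
have D : is_derive t 1 (fun s => Y0 a b + primitive (fun s => (y s *m B s) a b) s)
    ((y t *m B t) a b).
  rewrite -[X in is_derive _ _ _ X]add0r.
  apply: (@is_deriveD _ _ _ (cst (Y0 a b))); exact: is_derive_primitive.
apply: near_eq_is_derive D.
have : \forall s \near t, s \in `]0, 1[%R by exact: near_in_itvoo.
apply: filterS => s; rewrite in_itv /= => /andP[s0 s1].
by rewrite mxE clamp_id // (ltW s0) ltW.
Qed.

Let picard_continuous y : continuous y -> continuous (picard y).
Proof.
move=> cy t; apply: mx_continuous => a b.
have cyB : continuous (fun s => (y s *m B s) a b).
  by move=> s; exact: (@continuous_mx_entry _ _ _ _ _ s a b (continuous_mulmx (cy s) (@cB s))).
have -> : (fun s => picard y s a b) =
    (fun s => Y0 a b + primitive (fun s => (y s *m B s) a b) (clamp s)).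
  by apply/funext => s; rewrite mxE.
apply: cvgD; first exact: cvg_cst.
apply: continuous_comp; first exact: clamp_continuous.
apply: differentiable_continuous; apply/derivable1_diffP.
have /andP[c0 _] := clamp01 t.
by have [] := @is_derive_primitive _ _ (clamp t) cyB (lt_le_trans (ltrN10 R) c0).
Qed.

Let picard_contraction y z (M : R) : continuous y -> continuous z ->
  (forall t, `|y t - z t| <= M) ->
  forall t, `|picard y t - picard z t| <= 2^-1 * M.
Proof.
move=> cy cz yzM t.
have M0 : 0 <= M by apply: le_trans (yzM 0).
have E : picard y t - picard z t = \matrix_(a, b) (
    primitive (fun s => (y s *m B s) a b) (clamp t) -
    primitive (fun s => (z s *m B s) a b) (clamp t)).
  by apply/matrixP => a b; rewrite !mxE opprD addrACA subrr add0r.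
have /andP[c0 c1] := clamp01 t.
pose w s : 'M[R]_(p, N) := \matrix_(a, b) (
    primitive (fun s => (y s *m B s) a b) s -
    primitive (fun s => (z s *m B s) a b) s).
have Dw s : 0 <= s -> mx_is_derive w s (y s *m B s - z s *m B s).
  move=> s0 a b.
  have s1 : -1 < s by rewrite (lt_le_trans _ s0) // ltrN10.
  have -> : (fun s => w s a b) = primitive (fun s => (y s *m B s) a b) -
      primitive (fun s => (z s *m B s) a b).
    by apply/funext => r; rewrite mxE.
  have -> : (y s *m B s - z s *m B s) a b = (y s *m B s) a b - (z s *m B s) a b.
    by rewrite [LHS]mxE [X in _ + X]mxE.
  apply: is_deriveB; apply: is_derive_primitive => // r.
    exact: (@continuous_mx_entry _ _ _ _ _ r a b (continuous_mulmx (cy r) (@cB r))).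
  exact: (@continuous_mx_entry _ _ _ _ _ r a b (continuous_mulmx (cz r) (@cB r))).
have w0 : w 0 = 0 by apply/matrixP => a b; rewrite !mxE !primitive0 subrr.
rewrite E -/(w (clamp t)) -[w _]subr0 -{1}w0.
apply: le_trans (mx_mvt_le (dy := fun s => y s *m B s - z s *m B s) c0 _ _
    (_ : 0 <= 2^-1 * M) _) _.
- by move=> s /andP[s0 _]; exact: mx_derive_continuous (Dw s s0).
- by move=> s /andP[s0 _]; exact: Dw (ltW s0).
- by rewrite mulr_ge0 // invr_ge0.
- move=> s _; rewrite -mulmxBl; apply: le_trans (mx_norm_mul _ _) _.
  apply: (@le_trans _ _ (N%:R * beta * M)).
    by rewrite -mulrA ler_wpM2l // mulrC ler_pM.
  by rewrite ler_wpM2r.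
by rewrite ler_piMl // mulr_ge0 // invr_ge0.
Qed.

Let iterate k := iter k picard (fun=> Y0).

Let iterate_continuous k : continuous (iterate k).
Proof.
elim: k => [|k IH]; last exact: picard_continuous.
by move=> t; exact: cvg_cst.
Qed.

Let iterate_step k t : `|iterate k.+1 t - iterate k t| <= `|Y0| * 2^-1 ^+ k.
Proof.
elim: k t => [|k IH] t.
  have p0 : picard (fun=> 0) t = Y0.
    apply/matrixP => a b; rewrite mxE /primitive.
    have -> : (fun s => ((0 : 'M[R]_(p, N)) *m B s) a b) = cst 0.
      by apply/funext => s; rewrite mul0mx mxE.
    by rewrite !Rintegral_cst // !mul0r subrr addr0.
  have := picard_contraction (y := fun=> Y0) (z := fun=> 0) (M := `|Y0|) _ _ _ t.
  rewrite p0 expr0 mulr1 => H; apply: le_trans (H _ _ _) _.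
  - by move=> s; exact: cvg_cst.
  - by move=> s; exact: cvg_cst.
  - by move=> s; rewrite subr0.
  by rewrite ler_piMl // invf_le1 // ler1n.
have := picard_contraction (@iterate_continuous k.+1) (@iterate_continuous k) IH t.
by rewrite exprS mulrCA.
Qed.

Let iterate_dist k m t :
  `|iterate (k + m) t - iterate k t| <= `|Y0| * 2^-1 ^+ k * 2.
Proof.
suff : `|iterate (k + m) t - iterate k t| <=
    `|Y0| * 2^-1 ^+ k * (2 - 2 * 2^-1 ^+ m).
  move=> /le_trans; apply; rewrite ler_wpM2l ?mulr_ge0 ?exprn_ge0 ?invr_ge0 //.
  by rewrite gerBl mulr_ge0 // exprn_ge0 // invr_ge0.
elim: m => [|m IH]; first by rewrite addn0 subrr normr0 expr0 mulr1 subrr mulr0.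
apply: le_trans (ler_distD (iterate (k + m) t) _ _) _.
rewrite addnS; apply: le_trans (lerD (iterate_step _ _) IH) _.
rewrite exprD exprS; move: (2^-1 ^+ k) (2^-1 ^+ m) `|Y0| => u v w.
by rewrite le_eqVlt; apply/orP; left; apply/eqP; field.
Qed.

Let half_pow_small (e : R) : 0 < e -> exists k, `|Y0| * 2^-1 ^+ k * 2 < e.
Proof.
move=> e0; have h1 : `|2^-1 : R| < 1 by rewrite ger0_norm ?invr_ge0 // invf_lt1 // ltr1n.
have /cvgrPdist_lt/(_ _ e0) := cvg_geometric (`|Y0| * 2) h1.
move=> /filter_ex[k /=]; rewrite sub0r normrN => H; exists k.
by apply: le_lt_trans H; rewrite mulrAC ler_norm.
Qed.

Let solution t : 'M[R]_(p, N) := limn (fun k => iterate k t).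

Let iterate_cvg t : (fun k => iterate k t) @ \oo --> solution t.
Proof.
apply/cauchy_cvgP/cauchy_exP => e e0.
have [k kP] := half_pow_small e0.
exists (iterate k t); exists k => // m /= km.
rewrite -ball_normE /= distrC -(subnKC km).
exact: le_lt_trans (iterate_dist _ _ _) kP.
Qed.

Let solution_dist k t : `|solution t - iterate k t| <= `|Y0| * 2^-1 ^+ k * 2.
Proof.
have c : (fun m => `|iterate (m + k)%N t - iterate k t|) @ \oo -->
    `|solution t - iterate k t|.
  apply: cvg_norm; apply: cvgB; last exact: cvg_cst.
  by rewrite (cvg_shiftn k (fun m => iterate m t)); exact: iterate_cvg.
rewrite -(cvg_lim _ c) //; apply: limr_le; first by apply/cvg_ex; eexists; exact: c.
by near=> m; rewrite addnC; exact: iterate_dist.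
Unshelve. all: by end_near. Qed.

Let solution_continuous : continuous solution.
Proof.
move=> t; apply/cvgrPdist_lt => e e0.
have [k kP] := half_pow_small (divr_gt0 e0 (ltr0Sn R 2)).
have /cvgrPdist_lt/(_ _ (divr_gt0 e0 (ltr0Sn R 2))) := @iterate_continuous k t.
apply: filterS => s ks.
have d1 := solution_dist k t; have d2 := solution_dist k s.
rewrite distrC in d2.
have T1 := ler_distD (iterate k t) (solution t) (solution s).
have T2 := ler_distD (iterate k s) (iterate k t) (solution s).
move: d1 d2 ks kP T1 T2.
move: `|solution t - iterate k t| `|iterate k s - solution s|.
move: `|iterate k t - iterate k s| `|solution t - solution s|.
by move: `|iterate k t - solution s| (_ * _ * 2) => u v w w' w'' z; lra.
Qed.

Let solution_fixed : picard solution = solution.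
Proof.
apply/funext => t; apply/eqP; rewrite -subr_eq0 -normr_le0.
apply/ler_addgt0Pr => e e0; rewrite add0r.
have [k kP] := half_pow_small e0.
have d := solution_dist k.+1 t.
have d' := picard_contraction (@solution_continuous) (@iterate_continuous k)
  (solution_dist k) t.
rewrite distrC in d.
apply: le_trans (ler_distD (iterate k.+1 t) _ _) _.
apply: le_trans (lerD d' d) _; rewrite exprS; apply/ltW.
by move: kP; move: (_ ^+ k) => u; move: `|Y0| => w; lra.
Qed.

(** The constant 3: the iterates start at [Y0], and the first step has size at
    most [|Y0|], so that the limit is within [2 |Y0|] of [Y0]. *)
Lemma linear_ode_global : exists y : R -> 'M[R]_(p, N),
  [/\ continuous y, y 0 = Y0, forall t, `|y t| <= 3 * `|Y0| &
      forall t, 0 < t < 1 -> mx_is_derive y t (y t *m B t)].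
Proof.
exists solution; split.
- exact: solution_continuous.
- rewrite -solution_fixed; apply/matrixP => a b; rewrite mxE clamp_id ?lexx ?ler01 //.
  by rewrite primitive0 addr0.
- move=> t; have := solution_dist 0 t; rewrite expr0 mulr1 /= => d.
  rewrite -[solution t](subrK Y0); apply: le_trans (ler_normD _ _) _.
  by move: d; move: `|_| `|_| => u v; lra.
by move=> t t01; rewrite -{1}solution_fixed; apply: picard_derive => //; exact: solution_continuous.
Qed.

End LinearODE.

Lemma linear_ode_solution {R : realType} p N (B : R -> 'M[R]_N) (beta : R)
    (Y0 : 'M[R]_(p, N)) :
  (forall t, 0 <= t <= 1 -> {for t, continuous B}) ->
  (forall t, 0 <= t <= 1 -> `|B t| <= beta) -> N%:R * beta <= 2^-1 ->
  exists y : R -> 'M[R]_(p, N),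
  [/\ continuous y, y 0 = Y0, forall t, `|y t| <= 3 * `|Y0| &
      forall t, 0 < t < 1 -> mx_is_derive y t (y t *m B t)].
Proof.
move=> cB Bb b2.
have cBc : continuous (B \o clamp).
  by move=> t; apply: continuous_comp; [exact: clamp_continuous|exact: cB (clamp01 t)].
have [y [cy y0 yb Dy]] := linear_ode_global Y0 cBc (fun t => Bb _ (clamp01 t)) b2.
exists y; split=> // t t01; have := Dy t t01; rewrite /= clamp_id //.
by case/andP: t01 => /ltW -> /ltW ->.
Qed.

(** * First and second order estimates on a ball *)

Lemma is_derive_mulr_cst {R : realType} (c s : R) :
  is_derive s 1 (fun u => u * c) c.
Proof.
have -> : (fun u => u * c) = (c \*: id) :> (R -> R).
  by apply/funext => u; rewrite mulrC.
rewrite -[X in is_derive _ _ _ X]mulr1; apply: is_deriveZ.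
Qed.

(** A sum serves as common bound in order not to treat an empty family, which has
    no maximum, separately. *)
Lemma norm_near_bounded {R : realType} (T : topologicalType) (I : finType) p q
    (F : I -> T -> 'M[R]_(p, q)) x : (forall i, {for x, continuous (F i)}) ->
  \forall z \near x, forall i, `|F i z| <= \sum_i (`|F i x| + 1).
Proof.
move=> cF; apply: filter_forall => i.
have /cvgrPdist_lt/(_ _ ltr01) := cF i.
apply: filterS => z xz; apply: (@le_trans _ _ (`|F i x| + 1)).
  rewrite -[F i z](subrK (F i x)) addrC (le_trans (ler_normD _ _)) // lerD2l.
  by rewrite distrC ltW.
by rewrite (bigD1 i) //= lerDl sumr_ge0 // => j _; rewrite addr_ge0.
Qed.

Section TaylorEstimates.
Context {R : realType} {n : nat}.
Local Notation E := 'rV[R]_n.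

(** The value on the vector [h] of the matrix-valued one-form with
    components [G j]. *)
Definition lin p q (h : E) (G : 'I_n -> 'M[R]_(p, q)) : 'M[R]_(p, q) :=
  \sum_j h 0 j *: G j.

Lemma lin_le p q (h : E) (G : 'I_n -> 'M[R]_(p, q)) (K : R) :
  (forall j, `|G j| <= K) -> `|lin h G| <= n%:R * K * `|h|.
Proof.
move=> GK; apply: le_trans (ler_norm_sum _ _ _) _.
apply: (@le_trans _ _ (\sum_(j < n) K * `|h|)).
  by apply: ler_sum => j _; rewrite normrZ mulrC ler_pM // mx_entry_le.
by rewrite sumr_const card_ord -mulrA mulr_natl.
Qed.

Lemma linB p q (h : E) (G G' : 'I_n -> 'M[R]_(p, q)) :
  lin h (fun j => G j - G' j) = lin h G - lin h G'.
Proof. by rewrite /lin -sumrB; apply: eq_bigr => j _; rewrite scalerBr. Qed.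

Lemma linD p q (h : E) (G G' : 'I_n -> 'M[R]_(p, q)) :
  lin h (fun j => G j + G' j) = lin h G + lin h G'.
Proof. by rewrite /lin -big_split; apply: eq_bigr => j _; rewrite scalerDr. Qed.

Lemma lin_scaler p q c (h : E) (G : 'I_n -> 'M[R]_(p, q)) :
  lin h (fun j => c *: G j) = c *: lin h G.
Proof.
by rewrite /lin scaler_sumr; apply: eq_bigr => j _; rewrite !scalerA mulrC.
Qed.

Lemma lin_addl p q (h k : E) (G : 'I_n -> 'M[R]_(p, q)) :
  lin (h + k) G = lin h G + lin k G.
Proof.
by rewrite /lin -big_split; apply: eq_bigr => j _; rewrite mxE scalerDl.
Qed.

Lemma lin_scalel p q c (h : E) (G : 'I_n -> 'M[R]_(p, q)) :
  lin (c *: h) G = c *: lin h G.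
Proof.
by rewrite /lin scaler_sumr; apply: eq_bigr => j _; rewrite mxE scalerA.
Qed.

Lemma lin0l p q (G : 'I_n -> 'M[R]_(p, q)) : lin 0 G = 0.
Proof. by rewrite /lin big1 // => j _; rewrite mxE scale0r. Qed.

Lemma lin_mulr p q r (h : E) (G : 'I_n -> 'M[R]_(p, q)) (A : 'M[R]_(q, r)) :
  lin h G *m A = lin h (fun j => G j *m A).
Proof. by rewrite /lin mulmx_suml; apply: eq_bigr => j _; rewrite scalemxAl. Qed.

Lemma lin_mull p q r (h : E) (G : 'I_n -> 'M[R]_(p, q)) (A : 'M[R]_(r, p)) :
  A *m lin h G = lin h (fun j => A *m G j).
Proof. by rewrite /lin mulmx_sumr; apply: eq_bigr => j _; rewrite scalemxAr. Qed.

Lemma lin_exchange p q (h k : E) (G : 'I_n -> 'I_n -> 'M[R]_(p, q)) :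
  lin h (fun i => lin k (fun j => G i j)) = lin k (fun j => lin h (fun i => G i j)).
Proof.
rewrite /lin; under eq_bigr do rewrite scaler_sumr.
rewrite exchange_big; apply: eq_bigr => j _; rewrite scaler_sumr.
by apply: eq_bigr => i _; rewrite !scalerA mulrC.
Qed.

Lemma lin_eq p q (h : E) (G G' : 'I_n -> 'M[R]_(p, q)) :
  (forall j, G j = G' j) -> lin h G = lin h G'.
Proof. by move=> GG; apply: eq_bigr => j _; rewrite GG. Qed.

Lemma mx_is_derive_line p q (F : E -> 'M[R]_(p, q)) (x v : E) (t : R) :
  mxdiff F (x + t *: v) ->
  mx_is_derive (fun s => F (x + s *: v)) t (lin v (fun j => dmx j F (x + t *: v))).
Proof.
move=> dF a b; have := is_derive_line (dF a b).
rewrite derive_rV // /lin summxE.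
by under [X in _ -> is_derive _ _ _ X]eq_bigr do rewrite mxE dmxE.
Qed.

Lemma ball_segment (x z k : E) (r s : R) : ball x r z -> ball x r (z + k) ->
  0 <= s <= 1 -> ball x r (z + s *: k).
Proof.
rewrite -ball_normE /ball_ /= => b1 b2 /andP[s0 s1].
have -> : x - (z + s *: k) = (1 - s) *: (x - z) + s *: (x - (z + k)).
  by apply/rowP => j; rewrite !mxE; ring.
move: s0; rewrite le_eqVlt => /predU1P[<-|s0].
  by rewrite scale0r addr0 subr0 scale1r.
apply: le_lt_trans (ler_normD _ _) _; rewrite !normrZ (gtr0_norm s0).
rewrite ger0_norm ?subr_ge0 //.
apply: (@lt_le_trans _ _ ((1 - s) * r + s * r)); last by rewrite -mulrDl subrK mul1r.
by rewrite ler_ltD // ?ltr_pM2l // ler_wpM2l ?subr_ge0 // ltW.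
Qed.

Section Estimates.
Variables (x : E) (r : R) (p q : nat) (F : E -> 'M[R]_(p, q)) (K : R).
Hypothesis sF : mxsmooth (ball x r) F.
Hypothesis K0 : 0 <= K.

Lemma lipschitz_on_ball (z k : E) :
  (forall z j, ball x r z -> `|dmx j F z| <= K) ->
  ball x r z -> ball x r (z + k) -> `|F (z + k) - F z| <= n%:R * K * `|k|.
Proof.
move=> FK bz bzk.
have bs s : 0 <= s <= 1 -> ball x r (z + s *: k) by exact: ball_segment.
have := @mx_mvt_le _ _ _ (fun s => F (z + s *: k))
  (fun s => lin k (fun j => dmx j F (z + s *: k))) 1 (n%:R * K * `|k|) ler01.
rewrite scale1r scale0r addr0 mul1r; apply.
- move=> s s01; apply: mx_derive_continuous; apply: mx_is_derive_line.
  exact: mxsmooth_diff sF (bs s s01).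
- move=> s /andP[s0 s1]; apply: mx_is_derive_line.
  by apply: (mxsmooth_diff sF); apply: bs; rewrite !ltW.
- by rewrite !mulr_ge0.
- by move=> s /andP[s0 s1]; apply: lin_le => j; apply: FK; apply: bs; rewrite !ltW.
Qed.

End Estimates.

(** The remainder is differentiated along the segment: its derivative is a
    difference of first derivatives, to which the Lipschitz bound applies. *)
Lemma taylor_on_ball (x : E) (r : R) p q (F : E -> 'M[R]_(p, q)) (K : R) z k :
  mxsmooth (ball x r) F -> 0 <= K ->
  (forall z i j, ball x r z -> `|dmx i (dmx j F) z| <= K) ->
  ball x r z -> ball x r (z + k) ->
  `|F (z + k) - F z - lin k (fun j => dmx j F z)| <=
    n%:R * (n%:R * K * `|k|) * `|k|.
Proof.
move=> sF K0 FK bz bzk.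
have oB : open (ball x r) by exact: ball_open.
have bs s : 0 <= s <= 1 -> ball x r (z + s *: k) by exact: ball_segment.
pose f s := F (z + s *: k) - s *: lin k (fun j => dmx j F z).
have Df s : 0 <= s <= 1 -> mx_is_derive f s
   (lin k (fun j => dmx j F (z + s *: k) - dmx j F z)).
  move=> s01 a b; rewrite linB.
  have D1 := mx_is_derive_line (mxsmooth_diff sF (bs s s01)) a b.
  have -> : (fun s => f s a b) = (fun s => F (z + s *: k) a b) -
     (fun s => s * lin k (fun j => dmx j F z) a b).
    by apply/funext => u; rewrite /f !mxE.
  have D2 : is_derive s 1 (fun s => s * lin k (fun j => dmx j F z) a b)
      (lin k (fun j => dmx j F z) a b).
    exact: is_derive_mulr_cst.
  have -> : (lin k (fun j => dmx j F (z + s *: k)) -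
      lin k (fun j => dmx j F z)) a b = lin k (fun j => dmx j F (z + s *: k)) a b
      - lin k (fun j => dmx j F z) a b by rewrite mxE [X in _ + X]mxE.
  exact: is_deriveB.
have := @mx_mvt_le _ _ _ f
  (fun s => lin k (fun j => dmx j F (z + s *: k) - dmx j F z)) 1
  (n%:R * (n%:R * K * `|k|) * `|k|) ler01.
have -> : f 1 - f 0 = F (z + k) - F z - lin k (fun j => dmx j F z).
  by rewrite /f !scale1r !scale0r addr0 subr0 addrAC.
rewrite mul1r; apply.
- by move=> s s01; apply: mx_derive_continuous; exact: Df.
- by move=> s /andP[s0 s1]; apply: Df; rewrite !ltW.
- by rewrite !mulr_ge0.
move=> s /andP[s0 s1]; apply: lin_le => j.
have s01 : 0 <= s <= 1 by rewrite !ltW.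
apply: le_trans (lipschitz_on_ball (mxsmooth_dmx j oB sF) K0 _ bz (bs s s01)) _.
  by move=> w i bw; exact: FK.
rewrite ler_wpM2l ?mulr_ge0 // normrZ ger0_norm ?(ltW s0) //.
by rewrite ler_piMl // ltW.
Qed.

Lemma mxsmooth_bounded (I : finType) p q (U : set E) (F : I -> E -> 'M[R]_(p, q)) x :
  open U -> U x -> (forall i, mxsmooth U (F i)) ->
  exists K d, [/\ 0 <= K, 0 < d & forall i z, ball x d z -> `|F i z| <= K].
Proof.
move=> oU Ux sF; exists (\sum_i (`|F i x| + 1)).
have cF i : {for x, continuous (F i)}.
  by apply: mx_continuous => a b; exact: (sF i a b 0%N x (mem_set Ux)).
have : nbhs (x : E) [set z | forall i, `|F i z| <= \sum_i (`|F i x| + 1)].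
  exact: (norm_near_bounded cF).
rewrite -nbhs_ballE => -[d /= d0 dP]; exists d; split=> //.
  by apply: sumr_ge0 => i _; rewrite addr_ge0.
by move=> i z bz; exact: dP.
Qed.

End TaylorEstimates.

(** * Linear total differential systems *)

Lemma eq_ler {R : realType} (a b : R) : a = b -> a <= b.
Proof. by move=> ->. Qed.

Section CurveCalculus.
Context {R : realType}.

Lemma mx_is_derive_mul p q r (F : R -> 'M[R]_(p, q)) (G : R -> 'M[R]_(q, r)) t
    (dF : 'M[R]_(p, q)) (dG : 'M[R]_(q, r)) :
  mx_is_derive F t dF -> mx_is_derive G t dG ->
  mx_is_derive (fun s => F s *m G s) t (dF *m G t + F t *m dG).
Proof.
move=> DF DG a b.
have -> : (fun s => (F s *m G s) a b) =
    \sum_k ((fun s => F s a k) * (fun s => G s k b)).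
  by apply/funext => s; rewrite mxE fct_sumE.
have -> : (dF *m G t + F t *m dG) a b =
    \sum_k (F t a k *: dG k b + G t k b *: dF a k).
  rewrite !mxE -big_split; apply: eq_bigr => k _.
  by rewrite /= addrC; congr (_ + _); rewrite mulrC.
apply: is_derive_sum => k.
by apply: is_deriveM; [exact: DF|exact: DG].
Qed.

Lemma mx_is_deriveB p q (F G : R -> 'M[R]_(p, q)) t (dF dG : 'M[R]_(p, q)) :
  mx_is_derive F t dF -> mx_is_derive G t dG ->
  mx_is_derive (fun s => F s - G s) t (dF - dG).
Proof.
move=> DF DG a b.
have -> : (fun s => (F s - G s) a b) = (fun s => F s a b) - (fun s => G s a b).
  by apply/funext => s; rewrite mxE [X in _ + X]mxE.
have -> : (dF - dG) a b = dF a b - dG a b by rewrite mxE [X in _ + X]mxE.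
by apply: is_deriveB; [exact: DF|exact: DG].
Qed.

Lemma mx_is_derive_cstD p q (C : 'M[R]_(p, q)) (G : R -> 'M[R]_(p, q)) t dG :
  mx_is_derive G t dG -> mx_is_derive (fun s => C + G s) t dG.
Proof.
move=> DG a b.
have -> : (fun s => (C + G s) a b) = cst (C a b) + (fun s => G s a b).
  by apply/funext => s; rewrite mxE.
rewrite -[dG a b]add0r.
by apply: is_deriveD; exact: DG.
Qed.

Lemma mx_is_derive_scalar N (t : R) :
  mx_is_derive (fun s => s%:M : 'M[R]_N) t 1%:M.
Proof.
move=> a b; have -> : (fun s : R => (s%:M : 'M[R]_N) a b) =
    (fun s => s * (a == b)%:R).
  by apply/funext => s; rewrite mxE mulr_natr.
by rewrite mxE; exact: is_derive_mulr_cst.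
Qed.

Let lin_entry n p q (A : 'I_n -> 'rV[R]_n -> 'M[R]_(p, q)) (h : 'rV[R]_n) a b :
  (fun z => lin h (fun j => A j z) a b) =
    (fun z => \sum_j cst (h 0 j) z * A j z a b).
Proof.
by apply/funext => y; rewrite /lin summxE; apply: eq_bigr => j _; rewrite mxE.
Qed.

Lemma mxdiff_lin n p q (A : 'I_n -> 'rV[R]_n -> 'M[R]_(p, q)) (h z : 'rV[R]_n) :
  (forall j, mxdiff (A j) z) -> mxdiff (fun z => lin h (fun j => A j z)) z.
Proof.
move=> dA a b; rewrite lin_entry; apply: differentiable_bigsum => j.
by apply: differentiableM; [exact: differentiable_cst|exact: dA].
Qed.

Lemma dmx_lin n p q (A : 'I_n -> 'rV[R]_n -> 'M[R]_(p, q)) (h z : 'rV[R]_n) i :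
  (forall j, mxdiff (A j) z) ->
  dmx i (fun z => lin h (fun j => A j z)) z = lin h (fun j => dmx i (A j) z).
Proof.
move=> dA; apply/matrixP => a b; rewrite dmxE lin_entry partial_sum => [|j].
  rewrite /lin summxE; apply: eq_bigr => j _.
  rewrite partialM; [|exact: differentiable_cst|exact: dA].
  by rewrite mxE dmxE /partial derive_cst mul0r add0r.
by apply: differentiableM; [exact: differentiable_cst|exact: dA].
Qed.

End CurveCalculus.

Section RowForm.
Context {R : realType} {n : nat}.

(** The differential of a solution is first obtained as a linear form with
    prescribed coefficients; the linear structure makes it available to the
    characterization of differentials by estimates. *)
Definition row_form (c : 'I_n -> R) (h : 'rV[R]_n) : R := \sum_j h 0 j * c j.

Lemma row_form_linear c : linear (row_form c).
Proof.
move=> a u v; rewrite /row_form scaler_sumr -big_split.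
by apply: eq_bigr => j _; rewrite !mxE mulrDl -mulrA.
Qed.

HB.instance Definition _ c := GRing.isLinear.Build R 'rV[R]_n R *:%R
  (row_form c) (row_form_linear c).

Lemma row_form_continuous c : continuous (row_form c).
Proof.
move=> h; apply: continuous_sum_at => j; apply: continuousM.
  exact: coord_continuous.
exact: (@cst_continuous _ _ (c j) h).
Qed.

End RowForm.

(** The total differential system [d_j Y = Y A_j].  The hypothesis [flat] is its
    integrability condition, the equality of the mixed derivatives of a
    solution.  The radius [r] is so small that all linear equations met below have
    Lipschitz constant at most one half. *)
Section Frobenius.
Context {R : realType} {n p N : nat}.
Local Notation E := 'rV[R]_n.
Variables (x0 : E) (rho K r : R) (A : 'I_n -> E -> 'M[R]_N).
Variable Y0 : 'M[R]_(p, N).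
Hypothesis sA : forall j, mxsmooth (ball x0 rho) (A j).
Hypothesis K0 : 0 <= K.
Hypothesis AK : forall j z, ball x0 rho z -> `|A j z| <= K.
Hypothesis dAK : forall i j z, ball x0 rho z -> `|dmx i (A j) z| <= K.
Hypothesis ddAK : forall i j k z, ball x0 rho z ->
  `|dmx i (dmx j (A k)) z| <= K.
Hypothesis flat : forall i j z, ball x0 rho z ->
  dmx i (A j) z + A i z *m A j z = dmx j (A i) z + A j z *m A i z.
Let m : R := n%:R.
Let kap := m * K.
Let kap1 := kap * (1 + m).
Hypothesis r0 : 0 < r.
Hypothesis r1 : r <= 1.
Hypothesis r_rho : r <= rho.
Hypothesis r_small : N%:R * (kap * r + 2 * kap1 * r) <= 2^-1.

Let Ax (v z : E) := lin v (fun j => A j z).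

Let m0 : 0 <= m. Proof. exact: ler0n. Qed.
Let kap0 : 0 <= kap. Proof. exact: mulr_ge0. Qed.
Let kap10 : 0 <= kap1. Proof. by rewrite mulr_ge0 // addr_ge0. Qed.

Let ray_in (v : E) t : `|v| < r -> 0 <= t <= 1 -> ball x0 rho (x0 + t *: v).
Proof.
move=> vr /andP[t0 t1]; rewrite -ball_normE /= opprD addNKr normrN normrZ.
rewrite ger0_norm //; apply: lt_le_trans r_rho; apply: le_lt_trans vr.
by rewrite ler_piMl.
Qed.

Let is_ray_solution (v : E) (y : R -> 'M[R]_(p, N)) :=
  [/\ continuous y, y 0 = Y0, forall t, `|y t| <= 3 * `|Y0| &
      forall t, 0 < t < 1 -> mx_is_derive y t (y t *m Ax v (x0 + t *: v))].

Let Ax_le v z : ball x0 rho z -> `|Ax v z| <= kap * `|v|.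
Proof. by move=> bz; apply: lin_le => j; exact: AK. Qed.

Let Ax_line (v h : E) t : `|v| < r -> 0 <= t <= 1 ->
  mx_is_derive (fun s => Ax h (x0 + s *: v)) t
    (lin v (fun i => lin h (fun j => dmx i (A j) (x0 + t *: v)))).
Proof.
move=> vr t01.
have dA j : mxdiff (A j) (x0 + t *: v).
  by apply: mxsmooth_diff (sA j) _; exact: ray_in.
have := mx_is_derive_line (mxdiff_lin h dA).
by congr (mx_is_derive _ _ _); apply: lin_eq => i; rewrite dmx_lin.
Qed.

Let ray_solution_exists (v : E) : exists y, `|v| < r -> is_ray_solution v y.
Proof.
have [vr|_] := boolP (`|v| < r); last by exists (fun=> 0).
pose B t := Ax v (x0 + t *: v).
have cB t : 0 <= t <= 1 -> {for t, continuous B}.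
  by move=> t01; exact: mx_derive_continuous (Ax_line v vr t01).
have Bb t : 0 <= t <= 1 -> `|B t| <= kap * r.
  move=> t01; apply: le_trans (Ax_le _ (ray_in vr t01)) _.
  by rewrite ler_wpM2l // ltW.
have small : N%:R * (kap * r) <= 2^-1.
  apply: le_trans r_small; rewrite ler_wpM2l // lerDl.
  by apply: mulr_ge0; [exact: mulr_ge0|exact: ltW].
by have [y yP] := linear_ode_solution Y0 cB Bb small; exists y.
Qed.

(* The first summand bounds the remainders of the Taylor expansions of
   the coefficients between the two rays, the second one the term of
   [defect_derivative] that is quadratic in the step. *)
Let C := N%:R * (3 * `|Y0|) * (m * (m * kap) + m * kap)
  + N%:R * (3 * `|Y0|) * (N%:R * (kap * kap1)).

Let C0 : 0 <= C.
Proof. by rewrite /C addr_ge0 ?mulr_ge0 ?addr_ge0 ?mulr_ge0. Qed.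

(** The derivative of [y2 - y1 (1 + t H)], where [y1] and [y2] are solutions along
    the rays [v] and [v + h] and [H] is the value of the connection on [h] along
    the first ray.  Here [Q] is the derivative along [h] of the value
    on [v], and [H'] the derivative along [v] of the value on [h], so that [L] is
    flatness in the plane of [v] and [h].  It cancels the terms of first order
    in [h]: what remains is the defect itself times a bounded factor, and errors
    of second order. *)
Let defect_derivative (y1 y2 : 'M[R]_(p, N)) (Av H Q H' Av' Ah' B' : 'M[R]_N) (t : R) :
  Av *m H + H' = Q + H *m Av -> B' = Av' + Ah' ->
  y2 *m B' - (y1 *m Av *m (1%:M + t%:M *m H) +
    y1 *m (1%:M *m H + t%:M *m H')) =
  (y2 - y1 *m (1%:M + t%:M *m H)) *m (Av + (H + t *: Q))
  + y2 *m ((Av' - Av - t *: Q) + (Ah' - H))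
  + y1 *m (t *: (H *m (H + t *: Q))).
Proof.
move=> L ->.
have -> : y2 *m ((Av' - Av - t *: Q) + (Ah' - H)) =
    y2 *m (Av' + Ah') - y2 *m (Av + (H + t *: Q)).
  rewrite -mulmxBr; congr (_ *m _).
  by apply/matrixP => a b; rewrite !mxE; ring.
have -> : (y2 - y1 *m (1%:M + t%:M *m H)) *m (Av + (H + t *: Q)) =
   y2 *m (Av + (H + t *: Q))
   - y1 *m ((1%:M + t%:M *m H) *m (Av + (H + t *: Q))).
  by rewrite mulmxBl mulmxA.
have -> : y1 *m Av *m (1%:M + t%:M *m H) + y1 *m (1%:M *m H + t%:M *m H') =
    y1 *m ((1%:M + t%:M *m H) *m (Av + (H + t *: Q)))
    - y1 *m (t *: (H *m (H + t *: Q))).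
  rewrite -mulmxA -mulmxDr -mulmxBr; congr (_ *m _).
  have E : Av *m H = Q + H *m Av - H' by rewrite -L addrK.
  rewrite !mul_scalar_mx scale1r mulmxDr mulmx1 -scalemxAr E.
  rewrite mulmxDl mul1mx -scalemxAl mulmxDr.
  move: (H *m Av) (H *m (H + t *: Q)) => X1 X2.
  by apply/matrixP => a b; rewrite !mxE; ring.
move: (y2 *m (Av' + Ah')) (y2 *m (Av + (H + t *: Q))) => X1 X2.
move: (y1 *m ((1%:M + t%:M *m H) *m (Av + (H + t *: Q)))) => X3.
move: (y1 *m (t *: (H *m (H + t *: Q)))) => X4.
by apply/matrixP => a b; rewrite !mxE; ring.
Qed.

(** The main estimate: a step [h] of the end point of the ray changes the value of
    the solution by [A_h] times the value, up to [O(|h|^2)]. *)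
Let step_bound (v h : E) y1 y2 : `|v| < r -> `|v + h| < r ->
  is_ray_solution v y1 -> is_ray_solution (v + h) y2 ->
  `|y2 1 - y1 1 - y1 1 *m Ax h (x0 + v)| <= 2 * (C * `|h| ^+ 2).
Proof.
move=> vr vhr [cy1 y10 y1b Dy1] [cy2 y20 y2b Dy2].
pose z t : E := x0 + t *: v.
pose z' t : E := x0 + t *: (v + h).
have z'E t : z' t = z t + t *: h by rewrite /z /z' scalerDr addrA.
pose H t := Ax h (z t).
pose Q t := lin h (fun i => lin v (fun j => dmx i (A j) (z t))).
pose H' t := lin v (fun i => lin h (fun j => dmx i (A j) (z t))).
pose D t := y2 t - y1 t *m (1%:M + t%:M *m H t).
pose dD t := y2 t *m Ax (v + h) (z' t) -
  (y1 t *m Ax v (z t) *m (1%:M + t%:M *m H t) +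
    y1 t *m (1%:M *m H t + t%:M *m H' t)).
have DS t : 0 <= t <= 1 ->
    mx_is_derive (fun t => 1%:M + t%:M *m H t) t (1%:M *m H t + t%:M *m H' t).
  move=> t01; apply: mx_is_derive_cstD; apply: mx_is_derive_mul.
    exact: mx_is_derive_scalar.
  exact: Ax_line.
have h2 : `|h| <= 2 * r.
  rewrite -[h](addKr v) addrC (le_trans (ler_normD _ _)) // normrN.
  by rewrite mulr_natl mulr2n lerD // ltW.
have y0 : 0 <= 3 * `|Y0| by rewrite mulr_ge0.
have := @gronwall_half R p N D dD (C * `|h| ^+ 2) _ _ _ _ _ 1.
have -> : D 1 = y2 1 - y1 1 - y1 1 *m Ax h (x0 + v).
  by rewrite /D /H /z scale1r mul_scalar_mx scale1r mulmxDr mulmx1 opprD addrA.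
apply; last by rewrite ler01 lexx.
- by rewrite mulr_ge0 // exprn_ge0.
- move=> s s01; apply: cvgB; first exact: cy2.
  exact: (continuous_mulmx (cy1 s) (mx_derive_continuous (DS s s01))).
- move=> s s01; apply: mx_is_deriveB; first exact: Dy2.
  apply: mx_is_derive_mul; first exact: Dy1.
  by apply: DS; case/andP: s01 => /ltW -> /ltW ->.
- by rewrite /D y10 y20 mul_scalar_mx scale0r addr0 mulmx1 subrr.
move=> s /andP[/ltW s0 /ltW s1]; have s01 : 0 <= s <= 1 by rewrite s0 s1.
have bz : ball x0 rho (z s) by exact: ray_in.
have bz' : ball x0 rho (z s + s *: h) by rewrite -z'E; exact: ray_in.
have L : Ax v (z s) *m H s + H' s = Q s + H s *m Ax v (z s).
  have E1 : Ax v (z s) *m H s =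
      lin v (fun i => lin h (fun j => A i (z s) *m A j (z s))).
    by rewrite /Ax lin_mulr; apply: lin_eq => i; exact: lin_mull.
  have E2 : H s *m Ax v (z s) =
      lin h (fun i => lin v (fun j => A i (z s) *m A j (z s))).
    by rewrite /H /Ax lin_mulr; apply: lin_eq => i; exact: lin_mull.
  rewrite E1 E2 /H' /Q -!linD.
  transitivity (lin v (fun i => lin h (fun j =>
      A i (z s) *m A j (z s) + dmx i (A j) (z s)))).
    by apply: lin_eq => i; rewrite linD.
  rewrite lin_exchange; apply: lin_eq => i; rewrite -linD; apply: lin_eq => j.
  by rewrite addrC; exact: flat.
have EdD : dD s = D s *m (Ax v (z s) + (H s + s *: Q s))
    + y2 s *m ((Ax v (z' s) - Ax v (z s) - s *: Q s) + (Ax h (z' s) - H s))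
    + y1 s *m (s *: (H s *m (H s + s *: Q s))).
  by apply: defect_derivative => //; rewrite /Ax lin_addl.
rewrite EdD.
have Avb : `|Ax v (z s)| <= kap * r.
  by apply: le_trans (Ax_le _ bz) _; rewrite ler_wpM2l // ltW.
have Hb : `|H s| <= kap * `|h| by exact: Ax_le.
have v1 : `|v| <= 1 by rewrite (le_trans (ltW vr)).
have Qb : `|Q s| <= m * kap * `|h|.
  apply: lin_le => i; apply: le_trans (lin_le _ (K := K) _) _.
    by move=> j; exact: dAK.
  by rewrite ler_piMr.
have Pb : `|H s + s *: Q s| <= kap1 * `|h|.
  apply: le_trans (ler_normD _ _) _.
  rewrite /kap1 mulrDr mulr1 [kap * m]mulrC mulrDl lerD //.
  by rewrite normrZ ger0_norm //; apply: le_trans Qb; rewrite ler_piMl.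
have Tb : N%:R * `|Ax v (z s) + (H s + s *: Q s)| <= 2^-1.
  apply: le_trans r_small; rewrite ler_wpM2l //.
  apply: le_trans (ler_normD _ _) _; rewrite lerD //.
  by apply: le_trans Pb _; apply: le_trans (ler_wpM2l kap10 h2) _; apply: eq_ler; ring.
have shle : `|s *: h| <= `|h| by rewrite normrZ ger0_norm // ler_piMl.
have sh2 : `|s *: h| * `|s *: h| <= `|h| ^+ 2 by rewrite expr2 ler_pM.
have T1b : `|Ax v (z' s) - Ax v (z s) - s *: Q s| <= m * (m * kap) * `|h| ^+ 2.
  have -> : s *: Q s =
      lin v (fun j => lin (s *: h) (fun i => dmx i (A j) (z s))).
    rewrite /Q lin_exchange -lin_scaler; apply: lin_eq => j.
    by rewrite lin_scalel.
  rewrite /Ax -!linB; apply: le_trans (lin_le (K := m * kap * `|h| ^+ 2) _ _) _.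
    move=> j; rewrite z'E; apply: le_trans (taylor_on_ball (sA j) K0 _ bz bz') _.
      by move=> w i k; exact: ddAK.
    apply: (@le_trans _ _ (m * kap * (`|s *: h| * `|s *: h|))).
      by apply: eq_ler; rewrite /kap /m; ring.
    by rewrite ler_wpM2l // mulr_ge0.
  apply: (@le_trans _ _ (m * (m * kap * `|h| ^+ 2))).
    by rewrite ler_piMr // !mulr_ge0 // exprn_ge0.
  by apply: eq_ler; ring.
have T2b : `|Ax h (z' s) - H s| <= m * kap * `|h| ^+ 2.
  apply: (@le_trans _ _ (m * (kap * `|h|) * `|h|)); last first.
    by apply: eq_ler; ring.
  rewrite /H /Ax -linB; apply: lin_le => j; rewrite z'E.
  apply: le_trans (lipschitz_on_ball (sA j) K0 _ bz bz') _.
    by move=> w i; exact: dAK.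
  by rewrite ler_wpM2l.
have Na : `|D s *m (Ax v (z s) + (H s + s *: Q s))| <= 2^-1 * `|D s|.
  apply: le_trans (mx_norm_mul _ _) _.
  by rewrite mulrCA [2^-1 * _]mulrC ler_wpM2l.
have Nb : `|y2 s *m ((Ax v (z' s) - Ax v (z s) - s *: Q s) + (Ax h (z' s) - H s))|
    <= N%:R * (3 * `|Y0|) * (m * (m * kap) + m * kap) * `|h| ^+ 2.
  apply: le_trans (mx_norm_mul _ _) _.
  rewrite -!(mulrA N%:R) ler_wpM2l // -mulrA ler_pM //.
  by rewrite mulrDl; apply: le_trans (ler_normD _ _) _; rewrite lerD.
have Nc : `|y1 s *m (s *: (H s *m (H s + s *: Q s)))| <=
    N%:R * (3 * `|Y0|) * (N%:R * (kap * kap1)) * `|h| ^+ 2.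
  apply: le_trans (mx_norm_mul _ _) _.
  rewrite -!(mulrA N%:R) ler_wpM2l // -mulrA ler_pM //.
  rewrite normrZ ger0_norm //.
  apply: (@le_trans _ _ `|H s *m (H s + s *: Q s)|); first by rewrite ler_piMl.
  apply: le_trans (mx_norm_mul _ _) _; rewrite -(mulrA N%:R) ler_wpM2l //.
  by rewrite expr2 mulrACA ler_pM.
apply: le_trans (ler_normD _ _) _.
apply: le_trans (lerD (le_trans (ler_normD _ _) (lerD Na Nb)) Nc) _.
by apply: eq_ler; rewrite /C; ring.
Qed.

Lemma pfaffian_on_ball : exists Y : E -> 'M[R]_(p, N),
  [/\ Y x0 = Y0, mxsmooth (ball x0 r) Y &
    forall x j, ball x0 r x -> dmx j Y x = Y x *m A j x].
Proof.
have [sol solP] := choice ray_solution_exists.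
pose Y x := sol (x - x0) 1.
have oB : open (ball x0 r) by exact: ball_open.
have sub : ball x0 r `<=` ball x0 rho by exact: le_ball.
have inr x : ball x0 r x -> `|x - x0| < r by rewrite -ball_normE /= distrC.
have YD x a b : ball x0 r x ->
    differentiable (fun y => Y y a b) x /\
    'd (fun y => Y y a b) x = row_form (fun j => (Y x *m A j x) a b) :> (E -> R).
  move=> bx; apply: differentiable_of_estimate; first exact: row_form_continuous.
  move=> e e0.
  have d0 : 0 < Num.min (r - `|x - x0|) (e / (2 * C + 1)).
    rewrite lt_min subr_gt0 inr //= divr_gt0 // ltr_wpDl // mulr_ge0 //.
  have : nbhs (0 : E) (ball (0 : E) (Num.min (r - `|x - x0|) (e / (2 * C + 1)))).
    exact: nbhsx_ballx.
  apply: filterS => h; rewrite -ball_normE /= sub0r normrN lt_min => /andP[h1 h2].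
  have vh : `|x - x0 + h| < r.
    by apply: le_lt_trans (ler_normD _ _) _; rewrite addrC -ltrBrDr.
  have := step_bound (inr x bx) vh (solP _ (inr x bx)) (solP _ vh).
  rewrite (_ : x0 + (x - x0) = x); last by rewrite addrC subrK.
  move=> bnd.
  have -> : Y (x + h) a b - Y x a b - row_form (fun j => (Y x *m A j x) a b) h =
      (Y (x + h) - Y x - Y x *m Ax h x) a b.
    have -> P : (Y (x + h) - Y x - P) a b = Y (x + h) a b - Y x a b - P a b.
      by rewrite !mxE.
    congr (_ - _ - _); rewrite /row_form /Ax lin_mull /lin summxE.
    by apply: eq_bigr => j _; rewrite [RHS]mxE.
  apply: le_trans (mx_entry_le _ _ _) _.
  have -> : Y (x + h) = sol (x - x0 + h) 1 by rewrite /Y addrAC.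
  apply: le_trans bnd _.
  rewrite expr2 !mulrA ler_wpM2r //.
  move: h2; rewrite ltr_pdivlMr ?ltr_wpDl ?mulr_ge0 // => h2.
  apply: ltW; apply: le_lt_trans h2.
  by rewrite (mulrDr `|h|) mulr1 [`|h| * _]mulrC lerDl.
have Yd x a b : ball x0 r x -> differentiable (fun y => Y y a b) x.
  by move=> bx; have [] := YD x a b bx.
have Yp x a b j : ball x0 r x ->
    partial j (fun y => Y y a b) x = (Y x *m A j x) a b.
  move=> bx; have [dY E1] := YD x a b bx.
  rewrite /partial deriveE // E1 /row_form (bigD1 j) //= big1 => [|k kj].
    by rewrite addr0 mxE !eqxx mul1r.
  by rewrite mxE (negPf kj) andbF mul0r.
exists Y; split.
(* On the constant ray the equation reads y' = 0. *)
- have x00 : `|x0 - x0| < r by rewrite subrr normr0.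
  have [cy y0 _ Dy] := solP _ x00.
  have := @mx_mvt_le _ _ _ (sol (x0 - x0)) (fun=> 0) 1 0 ler01 (fun s _ => cy s).
  rewrite mulr0 y0 => H; apply/eqP.
  rewrite -subr_eq0 -normr_le0 /Y; apply: H => //.
    move=> s s01; have := Dy s s01; rewrite /Ax subrr.
    by rewrite lin0l mulmx0.
  by move=> s _; rewrite normr0.
(* Bootstrap: the partial derivatives of [Y] are sums of products of entries of
   [Y] and of smooth functions, hence of the class of [Y] itself. *)
- move=> a b k; elim: k a b => [|k IH] a b.
    by move=> x /[!inE] bx; exact: differentiable_continuous (Yd x a b bx).
  split=> [x bx|j]; first exact: Yd.
  have C1 : Ck_on k (ball x0 r) (fun y => \sum_l Y y a l * A j y l b).
    apply: Ck_on_sum => // l _; apply: Ck_onM => //.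
    exact: (smooth_sub sub (sA j l b)).
  by apply: Ck_on_ext C1 => // x bx; rewrite Yp // mxE.
by move=> x j bx; apply/matrixP => a b; rewrite dmxE Yp.
Qed.

End Frobenius.

(** Frobenius' theorem for linear systems: flatness is sufficient for local
    solutions with a prescribed value at a point. *)
Theorem pfaffian_local {R : realType} n p N (U : set 'rV[R]_n) (x0 : 'rV[R]_n)
    (A : 'I_n -> 'rV[R]_n -> 'M[R]_N) (Y0 : 'M[R]_(p, N)) :
  open U -> U x0 -> (forall j, mxsmooth U (A j)) ->
  (forall i j z, U z ->
    dmx i (A j) z + A i z *m A j z = dmx j (A i) z + A j z *m A i z) ->
  exists r, 0 < r /\ ball x0 r `<=` U /\ exists Y : 'rV[R]_n -> 'M[R]_(p, N),
    [/\ Y x0 = Y0, mxsmooth (ball x0 r) Y &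
      forall x j, ball x0 r x -> dmx j Y x = Y x *m A j x].
Proof.
move=> oU Ux sA flat.
have [K1 [d1 [K10 d10 P1]]] := mxsmooth_bounded oU Ux sA.
have sdA (ij : 'I_n * 'I_n) : mxsmooth U (dmx ij.1 (A ij.2)).
  exact: mxsmooth_dmx.
have [K2 [d2 [K20 d20 P2]]] := mxsmooth_bounded oU Ux sdA.
have sddA (ijk : 'I_n * 'I_n * 'I_n) :
    mxsmooth U (dmx ijk.1.1 (dmx ijk.1.2 (A ijk.2))).
  by apply: mxsmooth_dmx => //; exact: mxsmooth_dmx.
have [K3 [d3 [K30 d30 P3]]] := mxsmooth_bounded oU Ux sddA.
have [d4 d40 P4] := open_subball_at oU Ux.
pose rho := Num.min (Num.min d1 d2) (Num.min d3 d4).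
have rho0 : 0 < rho by rewrite !lt_min d10 d20 d30 d40.
have b1 z : ball x0 rho z -> ball x0 d1 z.
  by apply: le_ball; rewrite !ge_min lexx.
have b2 z : ball x0 rho z -> ball x0 d2 z.
  by apply: le_ball; rewrite !ge_min lexx orbT.
have b3 z : ball x0 rho z -> ball x0 d3 z.
  by apply: le_ball; rewrite !ge_min lexx !orbT.
have b4 z : ball x0 rho z -> U z.
  by move=> bz; apply: P4; apply: le_ball bz; rewrite !ge_min lexx !orbT.
pose K := K1 + K2 + K3.
have K0 : 0 <= K by rewrite !addr_ge0.
pose c := N%:R * (n%:R * K + 2 * (n%:R * K * (1 + n%:R))).
have c0 : 0 <= c by rewrite /c !mulr_ge0 // addr_ge0 // !mulr_ge0 // addr_ge0.
have c1 : 0 < c + 1 by rewrite ltr_wpDl.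
(* [c] is the coefficient of [r] in the smallness condition; [c + 1] is positive
   even when [c] vanishes. *)
have [r [r0 r1 rr rc]] :
    exists r : R, [/\ 0 < r, r <= 1, r <= rho & r * (c + 1) <= 2^-1].
  exists (Num.min (Num.min 1 rho) (2^-1 / (c + 1))); split.
  - by rewrite lt_min (@divr_gt0 _ 2^-1) ?invr_gt0 // andbT lt_min ltr01 rho0.
  - by rewrite !ge_min lexx.
  - by rewrite ge_min ge_min lexx orbT.
  - by rewrite -ler_pdivlMr // ge_min lexx orbT.
have r_small : N%:R * (n%:R * K * r + 2 * (n%:R * K * (1 + n%:R)) * r) <= 2^-1.
  apply: le_trans rc; rewrite (mulrDr r) mulr1 -[leLHS]addr0 lerD ?(ltW r0) //.
  by apply: eq_ler; rewrite /c; ring.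
have sA' j : mxsmooth (ball x0 rho) (A j) by exact: mxsmooth_sub (sA j).
have AK j z : ball x0 rho z -> `|A j z| <= K.
  by move=> bz; apply: le_trans (P1 j z (b1 z bz)) _; rewrite /K -addrA lerDl addr_ge0.
have dAK i j z : ball x0 rho z -> `|dmx i (A j) z| <= K.
  move=> bz; apply: le_trans (P2 (i, j) z (b2 z bz)) _.
  by rewrite /K addrAC lerDr addr_ge0.
have ddAK i j k z : ball x0 rho z -> `|dmx i (dmx j (A k)) z| <= K.
  move=> bz; apply: le_trans (P3 (i, j, k) z (b3 z bz)) _.
  by rewrite /K lerDr addr_ge0.
exists r; split=> //; split; first by move=> z /(le_ball rr); exact: b4.
exact: (pfaffian_on_ball Y0 sA' K0 AK dAK ddAK (fun i j z bz => flat i j z (b4 z bz))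
  r0 r1 rr r_small).
Qed.

(** * Cholesky factors and projectors of rank one *)

Section LinearAlgebra.
Context {R : realType}.

Definition posdef n (A : 'M[R]_n) :=
  forall v : 'rV[R]_n, v != 0 -> 0 < (v *m A *m v^T) 0 0.

Lemma posdef_unitmx n (A : 'M[R]_n) : posdef A -> A \in unitmx.
Proof.
move=> pA; rewrite -row_free_unit -kermx_eq0; apply/eqP/row_matrixP => i.
rewrite row0; apply/eqP; apply: contraT => /pA.
by rewrite -row_mul mulmx_ker row0 mul0mx mxE ltxx.
Qed.

(** Induction on the size: clearing the first row and column with the pivot [a]
    leaves the Schur complement [c - a^-1 b^T b].  It is positive definite because
    its value at [v] is the value of [A] at the vector
    [(- a^-1 v b^T, v)], which is orthogonal for [A] to the first basis vector. *)
Lemma cholesky n (A : 'M[R]_n) : A^T = A -> posdef A ->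
  exists W : 'M[R]_n, W^T *m W = A.
Proof.
elim: n A => [|n IH] A symA pA.
  by exists 0; apply/matrixP => -[].
rewrite -add1n in A symA pA *.
pose a := ulsubmx A 0 0; pose b := ursubmx A; pose c := drsubmx A.
have Aul : ulsubmx A = a%:M by exact: mx11_scalar.
have Adl : dlsubmx A = b^T by rewrite /b trmx_ursub symA.
have symc : c^T = c by rewrite /c trmx_drsub symA.
have AE : A = block_mx a%:M b b^T c by rewrite -Aul -Adl submxK.
have a0 : 0 < a.
  have := pA (row_mx 1%:M 0); rewrite {}AE.
  rewrite mul_row_block tr_row_mx mul_row_col trmx0 trmx1.
  rewrite !mul0mx !mulmx0 !addr0 !mul1mx mulmx1 mxE eqxx mulr1n; apply.
  apply/eqP => /rowP/(_ 0); rewrite mxE; case: splitP => // j _.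
  by rewrite !mxE ord1 eqxx; apply/eqP; exact: oner_neq0.
pose s := Num.sqrt a.
have s0 : s != 0 by rewrite gt_eqF // sqrtr_gt0.
have ss : s * s = a by rewrite -expr2 sqr_sqrtr // ltW.
have [W' W'E] : exists W' : 'M[R]_n, W'^T *m W' = c - a^-1 *: (b^T *m b).
  apply: IH => [|v v0].
    by rewrite linearB /= symc linearZ /= trmx_mul trmxK.
  pose e := v *m b^T.
  have := pA (row_mx (- a^-1 *: e) v); rewrite AE.
  rewrite mul_row_block tr_row_mx mul_row_col.
  have -> : - a^-1 *: e *m a%:M + v *m b^T = 0.
    rewrite -/e mul_mx_scalar scalerA mulrN mulfV ?gt_eqF // scaleN1r.
    by rewrite addNr.
  rewrite mul0mx add0r => H; move: H.
  have -> : - a^-1 *: e *m b + v *m c = v *m (c - a^-1 *: (b^T *m b)).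
    by rewrite mulmxBr -scalemxAr mulmxA -scalemxAl scaleNr addrC.
  apply; apply: contraNneq v0 => /(congr1 (@rsubmx _ _ _ _)).
  by rewrite row_mxKr linear0 => ->.
exists (block_mx s%:M (s^-1 *: b) 0 W').
rewrite tr_block_mx mulmx_block AE.
rewrite trmx0 !mul0mx !mulmx0 !addr0 tr_scalar_mx -scalar_mxM ss W'E.
have -> : (s^-1 *: b)^T = s^-1 *: b^T by rewrite linearZ.
rewrite mul_scalar_mx scalerA mulfV // scale1r.
rewrite mul_mx_scalar scalerA mulfV // scale1r.
congr block_mx; rewrite -scalemxAl -scalemxAr scalerA -invfM ss.
by rewrite addrC subrK.
Qed.

(** A matrix of rank at most one is a column times a row. *)
Lemma rank1_minors m (Q : 'M[R]_m) t a b : Q^T = Q -> (\rank Q <= 1)%N ->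
  Q t a * Q t b = Q t t * Q a b.
Proof.
move=> symQ rQ.
have QE : Q = col_base Q *m row_base Q by rewrite mulmx_base.
have [u [v uv]] : exists u v : 'I_m -> R, forall i j, Q i j = u i * v j.
  move: (col_base Q) (row_base Q) QE; move: (\rank Q) rQ => [|[|//]] _ L M QE.
    exists (fun=> 0), (fun=> 0) => i' j'.
    by rewrite QE mxE big_ord0 mul0r.
  exists (fun i => L i 0), (fun j => M 0 j) => i' j'.
  by rewrite QE mxE big_ord1.
have sQ i j : Q i j = Q j i by rewrite -[in LHS]symQ mxE.
by rewrite [Q t a]sQ !uv; ring.
Qed.

(** Expanding [X] and [Y] as [Q X] and [Q Y] leaves a double sum of products
    [Q t a * Q t b], which the vanishing minors turn into [Q t t * Q a b]. *)
Lemma rank1_projected_product m n (Q : 'M[R]_m) (X Y : 'M[R]_(m, n)) t p i :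
  Q^T = Q -> (\rank Q <= 1)%N -> Q *m X = X -> Q *m Y = Y ->
  X t p * Y t i = Q t t * (X^T *m Y) p i.
Proof.
move=> symQ rQ QX QY.
have EX a : X a p = \sum_b Q a b * X b p by rewrite -{1}QX mxE.
have EY a : Y a i = \sum_b Q a b * Y b i by rewrite -{1}QY mxE.
have -> : (X^T *m Y) p i = \sum_a X a p * Y a i.
  by rewrite mxE; apply: eq_bigr => a _; rewrite mxE.
rewrite EX mulr_suml mulr_sumr; apply: eq_bigr => a _.
rewrite EY [in RHS]EY !mulr_sumr; apply: eq_bigr => b _.
rewrite mulrACA (rank1_minors t a b symQ rQ).
by rewrite -!mulrA; congr (_ * _); rewrite mulrCA.
Qed.

(** The matrix is the orthogonal projector onto the complement of the
    column space of [W], which has dimension [n]. *)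
Lemma normal_projector_rank m n (W : 'M[R]_(m, n)) (G : 'M[R]_n) :
  G \in unitmx -> W^T *m W = G ->
  (\rank (1%:M - W *m invmx G *m W^T)%R <= m - n)%N.
Proof.
move=> uG WG; set Q := _ - _.
have QW : Q *m W = 0.
  by rewrite mulmxBl mul1mx -!mulmxA WG mulVmx // mulmx1 subrr.
have rW : \rank W = n.
  apply/eqP; rewrite eqn_leq rank_leq_col /=.
  by rewrite -{1}(mxrank_unit uG) -WG mxrankM_maxr.
by have := mulmx0_rank_max QW; rewrite rW; move: (\rank Q) => k; lia.
Qed.

End LinearAlgebra.

(** * The Levi-Civita connection in matrix form *)

Lemma mx_subE {R : realType} p q (A B : 'M[R]_(p, q)) a b :
  (A - B) a b = A a b - B a b.
Proof. by rewrite !mxE. Qed.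

Lemma dmx_cst {R : realType} n p q (A : 'M[R]_(p, q)) i (x : 'rV[R]_n) :
  dmx i (fun=> A) x = 0.
Proof. by apply/matrixP => a b; rewrite dmxE mxE /partial derive_cst. Qed.

Lemma trmx_mulD {R : realType} p q r (A : 'M[R]_(p, q)) (B : 'M[R]_(q, r)) C :
  (A *m B + C)^T = B^T *m A^T + C^T.
Proof. by rewrite linearD /= trmx_mul. Qed.

Section LeviCivita.
Context {R : realType} {n : nat}.
Local Notation E := 'rV[R]_n.
Variables (U : set E) (G : E -> 'M[R]_n).
Hypothesis oU : open U.
Hypothesis sG : mxsmooth U G.
Hypothesis symG : forall x, U x -> (G x)^T = G x.
Hypothesis unitG : forall x, U x -> G x \in unitmx.

(** In the direction [j] the connection is the matrix with
    entry [Gamma^k_{ji}] in row [k] and column [i]; covariant derivatives and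
    the curvature become products of such matrices. *)
Definition christoffel_mx (j : 'I_n) x : 'M[R]_n :=
  \matrix_(k, i) christoffel G k j i x.

Local Notation Gam := christoffel_mx.

Lemma partial_metric_sym a b l x : U x ->
  partial l (fun y => G y a b) x = partial l (fun y => G y b a) x.
Proof.
move=> Ux; rewrite -!dmxE.
rewrite -[in RHS](dmx_ext (F := fun y => (G y)^T) l oU Ux symG) dmxT.
by rewrite [RHS]mxE.
Qed.

Lemma christoffel_sym k i j x : U x -> christoffel G k i j x = christoffel G k j i x.
Proof.
move=> Ux; rewrite /christoffel; congr (_ * _); apply: eq_bigr => l _.
by rewrite (partial_metric_sym i j) // [_ + partial j _ x]addrC.
Qed.

Lemma metric_christoffel j x : U x -> G x *m Gam j x =
  2^-1 *: (\matrix_(l, i) (partial j (fun y => G y l i) x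
    + partial i (fun y => G y l j) x - partial l (fun y => G y j i) x)).
Proof.
move=> Ux; set S := \matrix_(l, i) _.
have -> : Gam j x = 2^-1 *: (invmx (G x) *m S).
  apply/matrixP => k i; rewrite !mxE /christoffel; congr (_ * _).
  by apply: eq_bigr => l _; rewrite mxE.
by rewrite -scalemxAr mulmxA mulmxV ?unitG // mul1mx.
Qed.

Lemma christoffel_mx_smooth j : mxsmooth U (Gam j).
Proof.
have s : mxsmooth U (fun x => 2^-1 *: (invmx (G x) *m
  (\matrix_(l, i) (partial j (fun y => G y l i) x
    + partial i (fun y => G y l j) x - partial l (fun y => G y j i) x)))).
  apply: mxsmoothZ => //; first exact: smooth_cst.
  apply: mxsmoothM => //; first exact: mxsmooth_inv.
  apply: mxsmooth_mx => // l i; apply: smoothB => //.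
    by apply: smoothD => //; exact: smooth_partial.
  exact: smooth_partial.
apply: mxsmooth_ext s => // x Ux.
apply/matrixP => k i; rewrite !mxE /christoffel; congr (_ * _).
by apply: eq_bigr => l _; rewrite mxE.
Qed.

(** The metric is parallel: lowering the upper index gives the three derivatives of
    the metric with signs, and the transpose exchanges the two that cancel. *)
Lemma metric_compatible j x : U x ->
  dmx j G x = G x *m Gam j x + (G x *m Gam j x)^T.
Proof.
move=> Ux; rewrite metric_christoffel //; apply/matrixP => a b.
rewrite dmxE !mxE (partial_metric_sym b a) // (partial_metric_sym j a) //.
rewrite (partial_metric_sym j b) //.
move: (partial _ _ _) (partial _ _ _) (partial _ _ _) => c1 c2 c3.
by field.
Qed.

Definition curvature_mx (j k : 'I_n) x : 'M[R]_n :=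
  dmx j (Gam k) x - dmx k (Gam j) x + Gam j x *m Gam k x - Gam k x *m Gam j x.

Lemma riemannE p i j k x : riemann G p i j k x = (G x *m curvature_mx j k x) p i.
Proof.
rewrite /riemann [RHS]mxE; apply: eq_bigr => m _; congr (_ * _).
rewrite /riemann_up /curvature_mx.
have -> (X Y P Q : 'M[R]_n) : (X - Y + P - Q) m i = X m i - Y m i + (P m i - Q m i).
  by rewrite !mxE !addrA.
rewrite !dmxE; congr (_ - _ + _).
- by congr partial; apply/funext => y; rewrite mxE.
- by congr partial; apply/funext => y; rewrite mxE.
rewrite !mxE -sumrB; apply: eq_bigr => l _; rewrite !mxE.
by [].
Qed.

Definition differential_row (h : E -> R) x : 'rV[R]_n := \row_i partial i h x.

(** The covariant derivative of the differential of [h]. *)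
Definition hessian_row (h : E -> R) (j : 'I_n) x : 'rV[R]_n :=
  dmx j (differential_row h) x - differential_row h x *m Gam j x.

Lemma hessian_rowE h i j x : U x -> hessian G h i j x = hessian_row h j x 0 i.
Proof.
move=> Ux; rewrite /hessian /covector_deriv /hessian_row [RHS]mxE.
rewrite [X in _ = _ + X]mxE dmxE; congr (_ - _).
  by congr partial; apply/funext => y; rewrite mxE.
rewrite mxE; apply: eq_bigr => k _; rewrite !mxE mulrC.
by rewrite christoffel_sym.
Qed.

Lemma grad_sqnormE h x : grad_sqnorm G h x =
  (differential_row h x *m invmx (G x) *m (differential_row h x)^T) 0 0.
Proof.
rewrite /grad_sqnorm exchange_big mxE; apply: eq_bigr => b _ /=.
rewrite !mxE mulr_suml; apply: eq_bigr => a _; rewrite !mxE.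
by rewrite [invmx _ _ _ * _]mulrC.
Qed.

Lemma differential_row_smooth h : smooth_on U h -> mxsmooth U (differential_row h).
Proof. by move=> sh; apply: mxsmooth_mx => // _ i; exact: smooth_partial. Qed.

Lemma differential_row_closed h i j x : smooth_on U h -> U x ->
  dmx j (differential_row h) x 0 i = dmx i (differential_row h) x 0 j.
Proof.
move=> sh Ux; rewrite !dmxE.
have E k : (fun y => differential_row h y 0 k) = partial k h.
  by apply/funext => y; rewrite mxE.
by rewrite !E; exact: (partial_comm i j oU sh Ux).
Qed.

Lemma hessian_row_sym h i j x : smooth_on U h -> U x ->
  hessian_row h j x 0 i = hessian_row h i x 0 j.
Proof.
move=> sh Ux; rewrite /hessian_row !mx_subE.
rewrite (differential_row_closed i j sh Ux); congr (_ - _).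
rewrite mxE [RHS]mxE; apply: eq_bigr => m _; congr (_ * _).
by rewrite !mxE christoffel_sym.
Qed.

End LeviCivita.

(** * The Gauss equation of a hypersurface *)

Section Gauss.
Context {R : realType} {n m : nat}.
Local Notation E := 'rV[R]_n.
Variables (U : set E) (G : E -> 'M[R]_n).
Hypothesis oU : open U.
Hypothesis sG : mxsmooth U G.
Hypothesis symG : forall x, U x -> (G x)^T = G x.
Hypothesis unitG : forall x, U x -> G x \in unitmx.
Variable u : 'I_m -> E -> R.
Hypothesis su : forall t, smooth_on U (u t).

Definition immersion_mx x : 'M[R]_(m, n) := \matrix_(t, i) partial i (u t) x.
Local Notation W := immersion_mx.
Hypothesis WG : forall x, U x -> (W x)^T *m W x = G x.
Local Notation Gam := (christoffel_mx G).

Definition second_form (j : 'I_n) x : 'M[R]_(m, n) :=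
  dmx j W x - W x *m Gam j x.
Local Notation X := second_form.

Let sW : mxsmooth U W.
Proof. by apply: mxsmooth_mx => // t i; exact: smooth_partial. Qed.

Let sGam j : mxsmooth U (Gam j).
Proof. exact: christoffel_mx_smooth. Qed.

Let dW x : U x -> mxdiff W x.
Proof. exact: mxsmooth_diff. Qed.

Lemma second_formE t i j x : U x -> X j x t i = hessian G (u t) i j x.
Proof.
move=> Ux; rewrite (hessian_rowE oU symG) // /X /hessian_row !mx_subE !dmxE.
congr (_ - _).
  by congr partial; apply/funext => y; rewrite !mxE.
by rewrite !mxE; apply: eq_bigr => k _; rewrite !mxE.
Qed.

(** Koszul's formula.  The derivatives of [W^T W = G] express [d_k G] by the
    products [W^T d_j W], which are symmetric in the two indices of
    differentiation; solving for [W^T d_j W] gives the Christoffel symbols of the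
    first kind, that is [G Gam j]. *)
Lemma second_form_normal j x : U x -> (W x)^T *m X j x = 0.
Proof.
move=> Ux; rewrite mulmxBr mulmxA WG // (metric_christoffel unitG) //.
pose M j := (W x)^T *m dmx j W x.
have dG k : dmx k G x = (M k)^T + M k.
  rewrite -(dmx_ext (F := fun y => (W y)^T *m W y) k oU Ux WG).
  rewrite dmxM; [|exact: (mxsmooth_diff (mxsmoothT oU sW) Ux)|exact: dW].
  by rewrite dmxT trmx_mul trmxK.
have symM a b c : M a b c = M c b a.
  rewrite !mxE; apply: eq_bigr => t _; congr (_ * _); rewrite !dmxE.
  have E k : (fun y => W y t k) = partial k (u t).
    by apply/funext => y; rewrite mxE.
  by rewrite !E; exact: (partial_comm c a oU (su t) Ux).
have dGe k a b : partial k (fun y => G y a b) x = M k b a + M k a b.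
  by rewrite -dmxE dG mxE [X in X + _]mxE.
apply/eqP; rewrite subr_eq0; apply/eqP/matrixP => l i.
rewrite -/(M j) [RHS]mxE [X in _ = _ * X]mxE !dGe.
rewrite (symM j l i) (symM j i l) (symM i j l).
by field.
Qed.

(** Differentiating [W^T X = 0] gives the tangential part of the derivatives of
    [X].  The tangential parts of [d_j d_k W] and [d_k d_j W] are then known, and
    their equality is the asserted identity. *)
Lemma gauss_equation j k x : U x ->
  G x *m curvature_mx G j k x = (X j x)^T *m X k x - (X k x)^T *m X j x.
Proof.
move=> Ux.
have sX i : mxsmooth U (X i).
  apply: mxsmoothB => //; first exact: mxsmooth_dmx.
  by apply: mxsmoothM => //; exact: sGam.
have dWT : mxdiff (fun y => (W y)^T) x.
  exact: (mxsmooth_diff (mxsmoothT oU sW) Ux).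
have dX i : mxdiff (X i) x by exact: (mxsmooth_diff (sX i) Ux).
have dGm i : mxdiff (Gam i) x by exact: (mxsmooth_diff (sGam i) Ux).
have E1 i : dmx i W x = W x *m Gam i x + X i x by rewrite /X addrC subrK.
have E2 i l : (W x)^T *m dmx i (X l) x = - ((X i x)^T *m X l x).
  have : dmx i (fun y => (W y)^T *m X l y) x = 0.
    rewrite (dmx_ext (G := fun=> 0) i oU Ux (fun y => @second_form_normal l y)).
    exact: dmx_cst.
  rewrite dmxM // dmxT E1 trmx_mulD mulmxDl -mulmxA second_form_normal //.
  by rewrite mulmx0 add0r => /eqP; rewrite addrC addr_eq0 => /eqP.
have E3 i l : (W x)^T *m dmx i (dmx l W) x =
    G x *m (Gam i x *m Gam l x + dmx i (Gam l) x) - (X i x)^T *m X l x.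
  have -> : dmx l W = (fun y => W y *m Gam l y + X l y).
    by apply/funext => y; rewrite /X addrC subrK.
  have dWG : mxdiff (fun y => W y *m Gam l y) x.
    exact: (mxsmooth_diff (mxsmoothM oU sW (sGam l)) Ux).
  rewrite (dmxD _ dWG (dX l)).
  rewrite dmxM //; last exact: dW.
  rewrite [LHS]mulmxDr (E2 i l) E1; congr (_ - _).
  rewrite [LHS]mulmxDr !mulmxA WG // mulmxDr mulmxA WG // second_form_normal //.
  by rewrite addr0 -mulmxA -mulmxDr.
have := E3 j k; rewrite (dmx_comm k j oU sW Ux) E3 => E4.
rewrite /curvature_mx.
have -> : dmx j (Gam k) x - dmx k (Gam j) x + Gam j x *m Gam k x
    - Gam k x *m Gam j x = (Gam j x *m Gam k x + dmx j (Gam k) x)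
    - (Gam k x *m Gam j x + dmx k (Gam j) x).
  move: (Gam j x *m _) (Gam k x *m _) => P1 P2.
  by apply/matrixP => a b; rewrite !mxE; ring.
rewrite mulmxBr.
suff aux (P1 P2 P3 P4 : 'M[R]_n) : P2 - P4 = P1 - P3 -> P1 - P2 = P3 - P4.
  exact: aux E4.
move=> /eqP; rewrite subr_eq => /eqP ->.
by apply/matrixP => a b; rewrite !mxE; ring.
Qed.

Definition normal_projector x : 'M[R]_m :=
  1%:M - W x *m invmx (G x) *m (W x)^T.
Local Notation Q := normal_projector.

Lemma normal_projector_diag t x : Q x t t = 1 - grad_sqnorm G (u t) x.
Proof.
rewrite grad_sqnormE /Q mx_subE mxE eqxx mulr1n; congr (_ - _).
have rW : row t (W x) = differential_row (u t) x.
  by apply/rowP => i; rewrite !mxE.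
rewrite -rW tr_row -(row_mul t (W x)) [LHS]mxE [RHS]mxE.
by apply: eq_bigr => i _; rewrite !mxE.
Qed.

(** The trace of an orthogonal projector is its rank.  For [m = n + 1] it is 1, so
    that the diagonal entries cannot all be nonpositive. *)
Lemma normal_projector_trace x : U x -> \tr (Q x) = m%:R - n%:R.
Proof.
move=> Ux; rewrite linearB /= mxtrace1 mxtrace_mulC mulmxA WG //.
by rewrite mulmxV ?unitG // mxtrace1.
Qed.

Lemma second_form_hypersurface t p i j k x : (m = n.+1)%N -> U x ->
  X j x t p * X k x t i = Q x t t * ((X j x)^T *m X k x) p i.
Proof.
move=> mn Ux.
have symQ : (Q x)^T = Q x.
  rewrite linearB /= trmx1 !trmx_mul trmxK trmx_inv symG //.
  by rewrite mulmxA.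
have rQ : (\rank (Q x) <= 1)%N.
  have := normal_projector_rank (unitG Ux) (WG Ux).
  by move=> /leq_trans; apply; rewrite mn subSnn.
have QX l : Q x *m X l x = X l x.
  by rewrite /Q mulmxBl mul1mx -!mulmxA second_form_normal // !mulmx0 subr0.
exact: rank1_projected_product (QX j) (QX k).
Qed.

(** Each coordinate of a hypersurface satisfies the equation of a height function
    in a form without denominator, which remains valid where the gradient of the
    coordinate has norm one. *)
Theorem hypersurface_gauss t p i j k x : (m = n.+1)%N -> U x ->
  hessian G (u t) p j x * hessian G (u t) i k x
    - hessian G (u t) p k x * hessian G (u t) i j x =
  (1 - grad_sqnorm G (u t) x) * riemann G p i j k x.
Proof.
move=> mn Ux; rewrite -!second_formE // !second_form_hypersurface //.
rewrite -mulrBr -(normal_projector_diag t x) riemannE gauss_equation //.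
by congr (_ * _); rewrite mx_subE.
Qed.

End Gauss.

(** * The connection of the graph metric *)

(** Identities between constant matrices.  They are isolated from the
    calculus that produces their terms: [d] stands for the differential of the
    height function, [s] for its gradient and [k] for a row of its Hessian. *)
Section GraphAlgebra.
Context {R : realType} {n : nat}.
Implicit Types (G Gam Gi Rm : 'M[R]_n) (d k v : 'rV[R]_n) (s : 'cV[R]_n).

Let scalar_product (k : 'rV[R]_n) (s : 'cV[R]_n) : exists c,
  k *m s = c%:M /\ (k *m s) 0 0 = c.
Proof.
exists ((k *m s) 0 0); split=> //; exact: mx11_scalar.
Qed.

Lemma product_expand (a : R) (Gl Gj : 'M[R]_n) s (kl kj : 'rV[R]_n) :
  (Gl - a *: (s *m kl)) *m (Gj - a *: (s *m kj)) =
  Gl *m Gj - a *: (Gl *m s *m kj) - a *: (s *m (kl *m Gj))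
  + (a * a * (kl *m s) 0 0) *: (s *m kj).
Proof.
have t1 : Gl *m (a *: (s *m kj)) = a *: (Gl *m s *m kj).
  by rewrite -scalemxAr mulmxA.
have t2 : a *: (s *m kl) *m Gj = a *: (s *m (kl *m Gj)).
  by rewrite -scalemxAl mulmxA.
have t3 : a *: (s *m kl) *m (a *: (s *m kj)) = (a * a * (kl *m s) 0 0) *: (s *m kj).
  have [c [cE ->]] := scalar_product kl s.
  rewrite -scalemxAl -scalemxAr scalerA -[s *m kl *m _]mulmxA [kl *m _]mulmxA.
  by rewrite cE mul_scalar_mx -scalemxAr scalerA.
by rewrite mulmxBl !mulmxBr t1 t2 t3 opprB addrA addrAC.
Qed.

Lemma derivative_of_pairing k d Gam Gi s : d *m Gi = s^T ->
  (k + d *m Gam) *m s + d *m (Gi *m k^T - Gam *m s) = k *m s + (k *m s)^T.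
Proof.
move=> H; rewrite mulmxDl mulmxBr !mulmxA H trmx_mul.
by rewrite addrACA subrr addr0.
Qed.

Lemma solve_curvature G Rm (c : R) k1 k2 : G \in unitmx -> c != 0 ->
  c *: (G *m Rm) = k1^T *m k2 - k2^T *m k1 ->
  Rm = c^-1 *: (invmx G *m k1^T *m k2 - invmx G *m k2^T *m k1).
Proof.
move=> uG c0 H; rewrite -!mulmxA -mulmxBr -H -scalemxAr scalerA mulVf //.
by rewrite scale1r mulKmx.
Qed.

Lemma graph_metric_connection G Gam d k s (c : R) : c != 0 ->
  G *m s = d^T -> d *m s = (1 - c)%:M ->
  (G - d^T *m d) *m (Gam - c^-1 *: (s *m k)) = G *m Gam - d^T *m (k + d *m Gam).
Proof.
move=> c0 Gs ds.
have Hs : (G - d^T *m d) *m s = c *: d^T.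
  rewrite mulmxBl Gs -mulmxA ds mul_mx_scalar scalerBl scale1r opprB.
  by rewrite addrC subrK.
rewrite mulmxBr -scalemxAr mulmxA Hs -scalemxAl scalerA mulVf // scale1r.
rewrite mulmxBl mulmxDr mulmxA.
move: (G *m Gam) (d^T *m d *m Gam) (d^T *m k) => P1 P2 P3.
by apply/matrixP => i j; rewrite !mxE; ring.
Qed.

Lemma project_twice (a b c : R) d s (k1 k2 : 'rV[R]_n) (M P1 P2 : 'M[R]_n) :
  d *m P1 = a *: k1 -> d *m P2 = b *: k2 ->
  s *m (d *m (M + c *: (P1 - P2))) =
    s *m (d *m M) + c *: (a *: (s *m k1) - b *: (s *m k2)).
Proof.
move=> E1 E2; rewrite mulmxDr -scalemxAr mulmxBr E1 E2 mulmxDr -scalemxAr.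
by rewrite mulmxBr -!scalemxAr.
Qed.

(** The last step of the flatness of the graph connection: the left-hand side is
    the derivative computed in the order [(l, j)], the right-hand side in the
    order [(j, l)], after the curvature has been replaced by its value. *)
Lemma antisymmetric_part (a b c : R) (P1 P2 P3 P4 P5 P6 P7 : 'M[R]_n) :
  P7 + a *: (P1 - P2) - a *: P1 - (a * a * b) *: P5 - a *: P3
    + a *: (P4 + a *: (b *: P5 - c *: P6)) =
  P7 - a *: P2 - (a * a * c) *: P6 - a *: P3 + a *: P4.
Proof. by apply/matrixP => i k; rewrite !mxE; ring. Qed.

Lemma project_quadratic G d v s a c : s^T *m G = d -> G *m s = d^T ->
  d *m v^T = a%:M -> v *m d^T = a%:M -> d *m s = c%:M ->
  ((v - a *: s^T) *m G *m (v - a *: s^T)^T) 0 0 =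
  (v *m G *m v^T) 0 0 - a * a * (2 - c).
Proof.
move=> sG Gs dv vd ds.
have -> : (v - a *: s^T)^T = v^T - a *: s.
  by rewrite linearB /= linearZ /= trmxK.
rewrite mulmxBl -scalemxAl sG mulmxBr !mulmxBl -!scalemxAr -!scalemxAl dv ds.
rewrite -[v *m G *m s]mulmxA Gs vd.
move: (v *m G *m v^T) => P; rewrite !mxE eqxx !mulr1n.
ring.
Qed.

End GraphAlgebra.

Section GraphConnection.
Context {R : realType} {n : nat}.
Local Notation E := 'rV[R]_n.
Variables (U : set E) (G : E -> 'M[R]_n) (h : E -> R).
Hypothesis oU : open U.
Hypothesis sG : mxsmooth U G.
Hypothesis symG : forall x, U x -> (G x)^T = G x.
Hypothesis unitG : forall x, U x -> G x \in unitmx.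
Hypothesis sh : smooth_on U h.
Local Notation Gam := (christoffel_mx G).
Local Notation d := (differential_row h).
Local Notation K := (hessian_row G h).

Definition gradient x : 'cV[R]_n := invmx (G x) *m (d x)^T.
Local Notation s := gradient.

Definition conorm x : R := 1 - (d x *m s x) 0 0.
Local Notation nu := conorm.

Hypothesis nu0 : forall x, U x -> nu x != 0.
Hypothesis hyp_gauss : forall j k x, U x ->
  nu x *: (G x *m curvature_mx G j k x) =
    (K j x)^T *m K k x - (K k x)^T *m K j x.

(** These are the Christoffel matrices of [graph_metric]: they are symmetric
    ([graph_connection_sym]) and metric ([graph_metric_parallel]). *)
Definition graph_connection (j : 'I_n) x : 'M[R]_n :=
  Gam j x - (nu x)^-1 *: (s x *m K j x).
Local Notation C := graph_connection.

Definition graph_metric x : 'M[R]_n := G x - (d x)^T *m d x.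

Let sd : mxsmooth U d.
Proof. exact: differential_row_smooth. Qed.

Let ss : mxsmooth U s.
Proof. by apply: mxsmoothM => //; [exact: mxsmooth_inv|exact: mxsmoothT]. Qed.

Let sGam j : mxsmooth U (Gam j).
Proof. exact: christoffel_mx_smooth. Qed.

Let sK j : mxsmooth U (K j).
Proof. by apply: mxsmoothB => //; [exact: mxsmooth_dmx|exact: mxsmoothM]. Qed.

Let snu : smooth_on U nu.
Proof.
apply: smoothB => //; first exact: smooth_cst.
exact: (mxsmoothM oU sd ss 0 0).
Qed.

Let sV : smooth_on U (fun x => (nu x)^-1).
Proof. exact: smoothV. Qed.

Let ssK j : mxsmooth U (fun x => s x *m K j x).
Proof. exact: mxsmoothM. Qed.

Lemma graph_connection_smooth j : mxsmooth U (C j).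
Proof. by apply: mxsmoothB => //; exact: mxsmoothZ. Qed.

Let Gs x : U x -> G x *m s x = (d x)^T.
Proof. by move=> Ux; rewrite mulmxA mulmxV ?unitG // mul1mx. Qed.

Let sTG x : U x -> (s x)^T *m G x = d x.
Proof. by move=> Ux; rewrite -[G x in LHS]symG // -trmx_mul Gs // trmxK. Qed.

Let dGinv x : U x -> d x *m invmx (G x) = (s x)^T.
Proof. by move=> Ux; rewrite -(sTG Ux) mulmxK ?unitG. Qed.

Let dmx_d l x : dmx l d x = K l x + d x *m Gam l x.
Proof. by rewrite /hessian_row subrK. Qed.

Lemma dmx_gradient l x : U x ->
  dmx l s x = invmx (G x) *m (K l x)^T - Gam l x *m s x.
Proof.
move=> Ux.
have E1 : dmx l (fun y => G y *m s y) x = (dmx l d x)^T.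
  by rewrite -dmxT; apply: dmx_ext oU Ux _ => y; exact: Gs.
move: E1; rewrite dmxM; [|exact: (mxsmooth_diff sG Ux)|exact: (mxsmooth_diff ss Ux)].
rewrite (metric_compatible oU symG unitG l Ux) mulmxDl trmx_mul symG //.
rewrite -[_^T *m G x *m s x]mulmxA Gs // dmx_d linearD /= trmx_mul => E2.
have E3 : G x *m dmx l s x = (K l x)^T - G x *m Gam l x *m s x.
  move: E2; move: (G x *m dmx l s x) (G x *m Gam l x *m s x) => P1 P2.
  move: ((Gam l x)^T *m (d x)^T) (K l x)^T => P3 P4 E2.
  have -> : P1 = (P2 + P3 + P1) - P2 - P3.
    by apply/matrixP => a b; rewrite !mxE; ring.
  by rewrite E2; apply/matrixP => a b; rewrite !mxE; ring.
rewrite -(mulKmx (unitG Ux) (dmx l s x)) E3 mulmxBr; congr (_ - _).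
by rewrite -mulmxA mulKmx ?unitG.
Qed.

(* The derivative of [|dh|^2 / 2] in the direction [l]. *)
Let kappa l x := (K l x *m s x) 0 0.

Lemma partial_conorm l x : U x -> partial l nu x = - (2 * kappa l x).
Proof.
move=> Ux.
have E1 : dmx l (fun y => d y *m s y) x = K l x *m s x + (K l x *m s x)^T.
  rewrite dmxM; [|exact: (mxsmooth_diff sd Ux)|exact: (mxsmooth_diff ss Ux)].
  rewrite dmx_gradient // dmx_d.
  exact: derivative_of_pairing (dGinv Ux).
rewrite -[partial l nu x]/(partial l (fun y => cst 1 y - (d y *m s y) 0 0) x).
have ds := mxsmooth_diff (mxsmoothM oU sd ss) Ux 0 0.
rewrite partialD; [|exact: differentiable_cst|exact: differentiableN].
rewrite partialN // -dmxE E1 /partial derive_cst add0r.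
by congr (- _); rewrite mxE [X in _ + X]mxE -/(kappa l x) mulr_natl mulr2n.
Qed.

Lemma graph_connection_sym i j k x : U x -> C j x k i = C i x k j.
Proof.
move=> Ux.
have E a b : C a x k b = christoffel G k a b x - (nu x)^-1 * (s x k 0 * K a x 0 b).
  rewrite /graph_connection mx_subE; congr (_ - _); first by rewrite mxE.
  by rewrite mxE; congr (_ * _); rewrite mxE big_ord1.
apply: etrans (E j i) _; apply: etrans (esym (E i j)).
congr (_ - _ * (_ * _)); first exact: (christoffel_sym oU symG k j i Ux).
exact: (hessian_row_sym oU symG i j sh Ux).
Qed.

(* The curvature is the antisymmetric part of [Z]; the equation for [h] only
   controls this part. *)
Let Z l j x := dmx l (Gam j) x + Gam l x *m Gam j x.

Let curvatureZ l j x : curvature_mx G l j x = Z l j x - Z j l x.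
Proof.
rewrite /curvature_mx /Z; move: (dmx l _ _) (dmx j _ _) => P1 P2.
move: (_ *m _) (_ *m _) => P3 P4.
by apply/matrixP => a b; rewrite !mxE; ring.
Qed.

(** The right-hand side is arranged so that the exchange of [l] and [j]
    affects each term in a known way: [Z] changes by the curvature, the second
    derivatives of [d] are symmetric, and the other two terms are products of
    rows of the Hessian. *)
Lemma graph_connection_derivative l j x : U x ->
  dmx l (C j) x + C l x *m C j x =
  Z l j x - (nu x)^-1 *: (invmx (G x) *m (K l x)^T *m K j x)
  - ((nu x)^-1 * (nu x)^-1 * kappa l x) *: (s x *m K j x)
  - (nu x)^-1 *: (s x *m dmx l (dmx j d) x)
  + (nu x)^-1 *: (s x *m (d x *m Z l j x)).
Proof.
move=> Ux.
have dd := mxsmooth_diff sd Ux; have ds := mxsmooth_diff ss Ux.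
have dK := mxsmooth_diff (sK j) Ux; have dGm := mxsmooth_diff (sGam j) Ux.
have dV := smooth_differentiable sV Ux.
have E1 : dmx l (C j) x = dmx l (Gam j) x -
    (2 * kappa l x * ((nu x)^-1 * (nu x)^-1) *: (s x *m K j x) +
    (nu x)^-1 *: (dmx l s x *m K j x + s x *m dmx l (K j) x)).
  have dsK := mxsmooth_diff (ssK j) Ux.
  rewrite dmxB //; last exact: (mxsmooth_diff (mxsmoothZ oU sV (ssK j)) Ux).
  rewrite dmxZ // dmxM // partialV ?nu0 //; last exact: (smooth_differentiable snu Ux).
  by rewrite partial_conorm // opprK.
have E2 : C l x *m C j x = Gam l x *m Gam j x
    - (nu x)^-1 *: (Gam l x *m s x *m K j x)
    - (nu x)^-1 *: (s x *m (K l x *m Gam j x))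
    + ((nu x)^-1 * (nu x)^-1 * kappa l x) *: (s x *m K j x).
  exact: product_expand.
have E3 : dmx l (K j) x + K l x *m Gam j x = dmx l (dmx j d) x - d x *m Z l j x.
  rewrite dmxB; [|exact: (mxsmooth_diff (mxsmooth_dmx j oU sd) Ux)|].
    rewrite dmxM // dmx_d /Z mulmxDl mulmxDr -!mulmxA.
    move: (dmx l (dmx j d) x) (K l x *m Gam j x) => P1 P2.
    move: (d x *m (Gam l x *m Gam j x)) (d x *m dmx l (Gam j) x) => P3 P4.
    by apply/matrixP => a b; rewrite !mxE; ring.
  exact: (mxsmooth_diff (mxsmoothM oU sd (sGam j)) Ux).
have E4 : s x *m dmx l (dmx j d) x = s x *m dmx l (K j) x
    + s x *m (K l x *m Gam j x) + s x *m (d x *m Z l j x).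
  by rewrite -!mulmxDr E3 subrK.
rewrite E1 E2 E4 dmx_gradient // mulmxBl /Z.
move: (s x *m (d x *m _)) => P5.
move: (invmx (G x) *m (K l x)^T *m K j x) (Gam l x *m s x *m K j x) => P1 P2.
move: (s x *m dmx l (K j) x) (s x *m (K l x *m Gam j x)) => P3 P4.
move: (s x *m K j x) (Gam l x *m Gam j x) => P6 P7.
move: (dmx l _ x) (nu x)^-1 (kappa l x) => P8 a b.
by apply/matrixP => i k; rewrite !mxE; ring.
Qed.

(** The equation for [h] gives the curvature as
    [nu^-1 (G^-1 K_l^T K_j - G^-1 K_j^T K_l)].  Substituted in the difference of
    the two derivatives, the terms with [G^-1 K^T K] cancel directly, and those
    with [s K] cancel because [d G^-1 K_l^T = kappa l]. *)
Lemma graph_connection_flat l j x : U x ->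
  dmx l (C j) x + C l x *m C j x = dmx j (C l) x + C j x *m C l x.
Proof.
move=> Ux.
apply: etrans (graph_connection_derivative l j Ux) _.
apply: etrans (esym (graph_connection_derivative j l Ux)).
have Ec : dmx l (dmx j d) x = dmx j (dmx l d) x by exact: (dmx_comm j l oU sd Ux).
have nux := nu0 Ux.
have EZ : Z l j x = Z j l x + (nu x)^-1 *:
    (invmx (G x) *m (K l x)^T *m K j x - invmx (G x) *m (K j x)^T *m K l x).
  rewrite -(solve_curvature (unitG Ux) nux (hyp_gauss l j Ux)).
  by rewrite curvatureZ addrC subrK.
have Ek i k : d x *m (invmx (G x) *m (K i x)^T *m K k x) = kappa i x *: K k x.
  rewrite !mulmxA dGinv // -trmx_mul [K i x *m s x]mx11_scalar tr_scalar_mx.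
  by rewrite mul_scalar_mx.
have Es : s x *m (d x *m Z l j x) = s x *m (d x *m Z j l x) + (nu x)^-1 *:
    (kappa l x *: (s x *m K j x) - kappa j x *: (s x *m K l x)).
  apply: etrans (congr1 (fun M => s x *m (d x *m M)) EZ) _.
  exact: project_twice (Ek l j) (Ek j l).
rewrite Ec Es EZ; exact: antisymmetric_part.
Qed.

Lemma graph_metric_parallel j x : U x ->
  dmx j graph_metric x =
    (C j x)^T *m graph_metric x + graph_metric x *m C j x.
Proof.
move=> Ux.
have symH : (graph_metric x)^T = graph_metric x.
  by rewrite /graph_metric linearB /= trmx_mul trmxK symG.
have E1 : graph_metric x *m C j x = G x *m Gam j x - (d x)^T *m dmx j d x.
  rewrite dmx_d; apply: graph_metric_connection (nu0 Ux) (Gs Ux) _.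
  by rewrite [LHS]mx11_scalar /conorm opprB addrC subrK.
have dd := mxsmooth_diff sd Ux.
have ddT := mxsmooth_diff (mxsmoothT oU sd) Ux.
have -> : (C j x)^T *m graph_metric x = (graph_metric x *m C j x)^T.
  by rewrite trmx_mul symH.
rewrite E1 dmxB; [|exact: (mxsmooth_diff sG Ux)|].
  rewrite (metric_compatible oU symG unitG j Ux) dmxM // dmxT.
  rewrite linearB /= [((d x)^T *m _)^T]trmx_mul trmxK.
  move: (G x *m _) ((dmx j d x)^T *m d x) ((d x)^T *m dmx j d x) => P1 P2 P3.
  by apply/matrixP => i k; rewrite !mxE; ring.
exact: (mxsmooth_diff (mxsmoothM oU (mxsmoothT oU sd) sd) Ux).
Qed.

(** A form of the Cauchy-Schwarz inequality: the square of the length of [v - a s^T],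
    with [a] the derivative of [h] along [v], is nonnegative and equals
    [|v|^2 - a^2 - a^2 nu]. *)
Lemma graph_metric_posdef x : U x -> posdef (G x) -> 0 < nu x ->
  posdef (graph_metric x).
Proof.
move=> Ux pG nux v v0.
pose a := (v *m (d x)^T) 0 0.
have dv : d x *m v^T = a%:M.
  by rewrite -[LHS]trmxK trmx_mul trmxK [v *m _]mx11_scalar tr_scalar_mx.
have vd : v *m (d x)^T = a%:M by rewrite [LHS]mx11_scalar.
have ds : d x *m s x = (1 - nu x)%:M.
  by rewrite [LHS]mx11_scalar /conorm opprB addrC subrK.
have -> : (v *m graph_metric x *m v^T) 0 0 = (v *m G x *m v^T) 0 0 - a * a.
  rewrite /graph_metric mulmxBr mulmxBl mx_subE; congr (_ - _).
  by rewrite mulmxA vd -mulmxA dv -scalar_mxM mxE eqxx mulr1n.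
have [a0|a0] := eqVneq a 0; first by rewrite a0 mulr0 subr0; exact: pG.
pose w := v - a *: (s x)^T.
have w0 : 0 <= (w *m G x *m w^T) 0 0.
  have [->|/pG/ltW//] := eqVneq w 0.
  by rewrite mul0mx mul0mx mxE.
have wE := project_quadratic (sTG Ux) (Gs Ux) dv vd ds.
rewrite wE in w0.
have : 0 < a * a * nu x by rewrite mulr_gt0 // -expr2 exprn_even_gt0.
by move: w0; move: (_ 0 0) (a * a) => p q; lra.
Qed.

End GraphConnection.

(** * Flat coordinates of the graph metric *)

Section LocalRealization.
Context {R : realType} {n : nat}.
Local Notation E := 'rV[R]_n.

(** Uniqueness for linear differential inequalities: Gronwall's
    inequality along the rays from the centre. *)
Lemma vanishing_on_ball p q (x0 : E) (r K : R) (T : E -> 'M[R]_(p, q)) :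
  mxsmooth (ball x0 r) T -> T x0 = 0 -> 0 <= K ->
  (forall j z, ball x0 r z -> `|dmx j T z| <= K * `|T z|) ->
  n%:R * K * r <= 2^-1 -> forall z, ball x0 r z -> T z = 0.
Proof.
move=> sT T0 K0 dTK small z bz.
pose v := z - x0.
have vr : `|v| < r by move: bz; rewrite -ball_normE /= distrC.
have ray t : 0 <= t <= 1 -> ball x0 r (x0 + t *: v).
  move=> /andP[t0 t1]; rewrite -ball_normE /= opprD addNKr normrN normrZ.
  by rewrite ger0_norm //; apply: le_lt_trans vr; rewrite ler_piMl.
have D t : 0 <= t <= 1 -> mx_is_derive (fun s => T (x0 + s *: v)) t
    (lin v (fun j => dmx j T (x0 + t *: v))).
  by move=> t01; apply: mx_is_derive_line; exact: (mxsmooth_diff sT (ray t t01)).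
have := @gronwall_half R p q (fun s => T (x0 + s *: v))
  (fun t => lin v (fun j => dmx j T (x0 + t *: v))) 0 (lexx 0) _ _ _ _ 1.
rewrite scale1r (_ : x0 + v = z) ?mulr0; last by rewrite /v addrC subrK.
move=> H.
apply/eqP; rewrite -normr_le0; apply: H.
- by move=> s s01; exact: mx_derive_continuous (D s s01).
- by move=> s /andP[s0 s1]; apply: D; rewrite !ltW.
- by rewrite scale0r addr0.
- move=> s /andP[/ltW s0 /ltW s1]; rewrite addr0.
  have bs : ball x0 r (x0 + s *: v) by apply: ray; rewrite s0 s1.
  apply: le_trans (lin_le _ (K := K * `|T (x0 + s *: v)|) _) _.
    by move=> j; exact: dTK.
  rewrite mulrA mulrAC ler_wpM2r //; apply: le_trans small.
  by rewrite ler_wpM2l ?mulr_ge0 // ltW.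
by rewrite ler01 lexx.
Qed.

Lemma dmx_block_dr m k i (A : 'M[R]_m) (B : 'M[R]_(m, k)) (D : 'M[R]_(k, m))
    (F : E -> 'M[R]_k) x :
  dmx i (fun y => block_mx A B D (F y)) x = block_mx 0 0 0 (dmx i F x).
Proof.
apply/matrixP => a b; rewrite dmxE.
case: (split_ordP a) => a' ->; case: (split_ordP b) => b' ->.
- rewrite block_mxEul mxE /partial.
  under eq_fun do rewrite block_mxEul; exact: derive_cst.
- rewrite block_mxEur mxE /partial.
  under eq_fun do rewrite block_mxEur; exact: derive_cst.
- rewrite block_mxEdl mxE /partial.
  under eq_fun do rewrite block_mxEdl; exact: derive_cst.
rewrite block_mxEdr dmxE.
by under eq_fun do rewrite block_mxEdr.
Qed.

Lemma mxsmooth_block_dr m k (U : set E) (A : 'M[R]_m) (B : 'M[R]_(m, k))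
    (D : 'M[R]_(k, m)) (F : E -> 'M[R]_k) : open U ->
  mxsmooth U F -> mxsmooth U (fun y => block_mx A B D (F y)).
Proof.
move=> oU sF a b.
case: (split_ordP a) => a' ->; case: (split_ordP b) => b' ->.
- by under eq_fun do rewrite block_mxEul; exact: smooth_cst.
- by under eq_fun do rewrite block_mxEur; exact: smooth_cst.
- by under eq_fun do rewrite block_mxEdl; exact: smooth_cst.
by under eq_fun do rewrite block_mxEdr; exact: sF.
Qed.

Lemma gram_defect (A W S : 'M[R]_n) :
  (W *m A)^T *m W + W^T *m (W *m A) - (A^T *m S + S *m A) =
  A^T *m (W^T *m W - S) + (W^T *m W - S) *m A.
Proof. by rewrite trmx_mul mulmxBr mulmxBl !mulmxA opprD addrACA. Qed.

Lemma block_integrable (i j : 'I_n) (Ci Cj Di Dj : 'M[R]_n) :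
  (forall k, Ci k j = Cj k i) ->
  Di + Ci *m Cj = Dj + Cj *m Ci ->
  block_mx (0 : 'M_1) 0 0 Di + block_mx (0 : 'M_1) 0 (delta_mx i 0) Ci
      *m block_mx 0 0 (delta_mx j 0) Cj =
  block_mx 0 0 0 Dj + block_mx (0 : 'M_1) 0 (delta_mx j 0) Cj
      *m block_mx 0 0 (delta_mx i 0) Ci.
Proof.
move=> E0 E2; rewrite !mulmx_block.
have E1 : Ci *m (delta_mx j 0 : 'cV[R]_n) = Cj *m (delta_mx i 0 : 'cV[R]_n).
  by rewrite -!colE; apply/matrixP => k l; rewrite !mxE.
by rewrite !mul0mx !mulmx0 !addr0 !add0r !add_block_mx !addr0 !add0r E1 E2.
Qed.

Variables (U : set E) (G : E -> 'M[R]_n) (h : E -> R) (x0 : E).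
Hypothesis oU : open U.
Hypothesis Ux0 : U x0.
Hypothesis sG : mxsmooth U G.
Hypothesis symG : forall x, U x -> (G x)^T = G x.
Hypothesis posG : forall x, U x -> posdef (G x).
Hypothesis sh : smooth_on U h.
Local Notation Gam := (christoffel_mx G).
Local Notation d := (differential_row h).
Local Notation K := (hessian_row G h).
Local Notation nu := (conorm G h).
Hypothesis nu_gt0 : forall x, U x -> 0 < nu x.
Hypothesis hyp_gauss : forall j k x, U x ->
  nu x *: (G x *m curvature_mx G j k x) =
    (K j x)^T *m K k x - (K k x)^T *m K j x.
Local Notation C := (graph_connection G h).
Local Notation H := (graph_metric G h).

Let unitG x : U x -> G x \in unitmx.
Proof. by move=> /posG; exact: posdef_unitmx. Qed.

Let nu0 x : U x -> nu x != 0.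
Proof. by move=> /nu_gt0; rewrite lt0r => /andP[]. Qed.

Let sC j : mxsmooth U (C j).
Proof. exact: graph_connection_smooth. Qed.

(** One system for the functions and their frame: the row [(u, W)] times the block
    matrix is [(W e_j, W C_j)].  Integrability of the first column is the symmetry
    of the connection, that of the second one is its flatness. *)
Definition frame_system (j : 'I_n) x : 'M[R]_(1 + n) :=
  block_mx 0 0 (delta_mx j 0) (C j x).

Lemma frame_system_integrable i j x : U x ->
  dmx i (frame_system j) x + frame_system i x *m frame_system j x =
  dmx j (frame_system i) x + frame_system j x *m frame_system i x.
Proof.
move=> Ux.
have E k l : dmx k (frame_system l) x = block_mx 0 0 0 (dmx k (C l) x).
  exact: dmx_block_dr.
rewrite (E i j) (E j i); apply: block_integrable; last first.
  exact: (graph_connection_flat oU sG symG unitG sh nu0 hyp_gauss i j Ux).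
by move=> k; exact: (graph_connection_sym oU symG sh j i k Ux).
Qed.

(** The differential of [u] is the frame [W], and [W^T W = H] holds at the base
    point by the choice of the initial value.  It persists because both
    sides are parallel for the connection [C]. *)
Theorem graph_local_isometry : exists2 r, 0 < r & ball x0 r `<=` U /\
  exists u : 'I_n -> E -> R, (forall t, smooth_on (ball x0 r) (u t)) /\
  forall x a b, ball x0 r x ->
    \sum_t partial a (u t) x * partial b (u t) x
    + partial a h x * partial b h x = G x a b.
Proof.
have symH : (H x0)^T = H x0.
  by rewrite /graph_metric linearB /= trmx_mul trmxK symG.
have posH : posdef (H x0).
  exact: (graph_metric_posdef symG unitG Ux0 (posG Ux0) (nu_gt0 Ux0)).
have [W0 W0E] := cholesky symH posH.
have sB j : mxsmooth U (frame_system j) by exact: mxsmooth_block_dr.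
have [r1 [r10 [r1U [Y [Y0 sY dY]]]]] := pfaffian_local
  (row_mx (0 : 'cV[R]_n) W0) oU Ux0 sB frame_system_integrable.
pose W x : 'M[R]_n := rsubmx (Y x).
have ob : open (ball x0 r1) by exact: ball_open.
have sW : mxsmooth (ball x0 r1) W.
  move=> a b; apply: smooth_ext (sY a (rshift 1 b)) => // x _.
  by rewrite mxE.
have YB j x : Y x *m frame_system j x = row_mx (W x *m delta_mx j 0) (W x *m C j x).
  by rewrite -[in LHS](hsubmxK (Y x)) /frame_system mul_row_block !mulmx0 !add0r.
have dW j x : ball x0 r1 x -> dmx j W x = W x *m C j x.
  move=> bx; apply/matrixP => a b; rewrite dmxE.
  have -> : (fun y => W y a b) = (fun y => Y y a (rshift 1 b)).
    by apply/funext => y; rewrite mxE.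
  by rewrite -dmxE dY // YB row_mxEr.
pose u t x := Y x t (lshift n 0).
have du t j x : ball x0 r1 x -> partial j (u t) x = W x t j.
  move=> bx; rewrite -[partial j (u t) x]/(partial j (fun y => Y y t (lshift n 0)) x).
  rewrite -dmxE dY // YB row_mxEl -colE [LHS]mxE.
  by [].
pose T x := (W x)^T *m W x - H x.
have sH : mxsmooth U H.
  have sd := differential_row_smooth oU sh.
  by apply: mxsmoothB => //; apply: mxsmoothM => //; exact: mxsmoothT.
have sT : mxsmooth (ball x0 r1) T.
  apply: mxsmoothB => //; last exact: mxsmooth_sub sH.
  by apply: mxsmoothM => //; exact: mxsmoothT.
have T0 : T x0 = 0 by rewrite /T /W Y0 row_mxKr W0E subrr.
have dT j x : ball x0 r1 x -> dmx j T x = (C j x)^T *m T x + T x *m C j x.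
  move=> bx; have Ux := r1U x bx.
  have dWx := mxsmooth_diff sW bx.
  have dWT := mxsmooth_diff (mxsmoothT ob sW) bx.
  have dWW := mxsmooth_diff (mxsmoothM ob (mxsmoothT ob sW) sW) bx.
  rewrite dmxB //; last exact: (mxsmooth_diff sH Ux).
  rewrite dmxM // dmxT dW // (graph_metric_parallel oU sG symG unitG sh nu0 j Ux).
  exact: gram_defect.
have [K1 [r2 [K10 r20 CK]]] := mxsmooth_bounded oU Ux0 sC.
(* [d_j T = C_j^T T + T C_j], and the norm of each product costs a factor [n]. *)
pose K2 := 2 * (n%:R * K1).
have K20 : 0 <= K2 by rewrite !mulr_ge0.
have K2n : 0 < n%:R * K2 + 1 by rewrite ltr_wpDl // mulr_ge0.
have [r [r0 rr1 rr2 rK]] :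
    exists r : R, [/\ 0 < r, r <= r1, r <= r2 & r * (n%:R * K2 + 1) <= 2^-1].
  exists (Num.min (Num.min r1 r2) (2^-1 / (n%:R * K2 + 1))); split.
  - by rewrite lt_min (@divr_gt0 _ 2^-1) ?invr_gt0 // andbT lt_min r10 r20.
  - by rewrite !ge_min lexx.
  - by rewrite ge_min ge_min lexx orbT.
  - by rewrite -ler_pdivlMr // ge_min lexx orbT.
have TE x : ball x0 r x -> T x = 0.
  apply: (vanishing_on_ball (K := K2)) => //.
  - by apply: mxsmooth_sub sT; exact: le_ball.
  - move=> j z bz; rewrite dT; last exact: le_ball bz.
    have Cz : `|C j z| <= K1 by apply: CK; exact: le_ball bz.
    have CTz : `|(C j z)^T| <= K1.
      by apply: mx_norm_le => // a b; rewrite mxE (le_trans (mx_entry_le _ _ _)).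
    apply: le_trans (ler_normD _ _) _.
    have -> : K2 * `|T z| = n%:R * K1 * `|T z| + n%:R * K1 * `|T z|.
      by rewrite /K2; ring.
    rewrite lerD //.
      apply: le_trans (mx_norm_mul _ _) _.
      by rewrite -mulrA ler_wpM2l // ler_wpM2r.
    apply: le_trans (mx_norm_mul _ _) _.
    by rewrite -mulrA ler_wpM2l // mulrC ler_wpM2r.
  apply: le_trans rK; rewrite mulrDr mulr1 -[leLHS]addr0 lerD ?(ltW r0) //.
  by rewrite mulrC.
exists r => //; split; first by move=> z bz; apply: r1U; exact: le_ball bz.
exists u; split=> [t|x a b bx].
  apply: smooth_sub (sY t (lshift n 0)); exact: le_ball.
have bx1 : ball x0 r1 x by exact: le_ball bx.
have /eqP := TE x bx; rewrite subr_eq0 => /eqP/matrixP/(_ a b).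
rewrite /graph_metric mx_subE => E.
have -> : \sum_t partial a (u t) x * partial b (u t) x = ((W x)^T *m W x) a b.
  by rewrite [RHS]mxE; apply: eq_bigr => t _; rewrite !du // [in RHS]mxE.
rewrite E.
have -> : ((d x)^T *m d x) a b = partial a h x * partial b h x.
  by rewrite mxE big_ord1 !mxE.
by rewrite subrK.
Qed.

End LocalRealization.

(** * Charts, and the height function of an immersion *)

Section ChartTopology.
Context {R : realType} {n : nat} {M : topologicalType}.
Implicit Types c : chart R n M.

Lemma chart_inv_map c q : is_chart c -> chart_dom c q ->
  chart_inv c (chart_map c q) = q.
Proof. by move=> [_ _ cK _ _] cq; apply: cK; rewrite inE. Qed.

Lemma open_chart_image c (W : set M) : is_chart c -> open W ->
  open (chart_map c @` (W `&` chart_dom c)).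
Proof.
move=> hc oW; have [od oc _ _ ci] := hc.
rewrite openE => _ [q [Wq dq] <-].
have cq : chart_cod c (chart_map c q) by exists q.
have n1 : nbhs (chart_map c q) (chart_cod c) by exact: open_nbhs_nbhs.
have n2 : nbhs (chart_map c q) (chart_inv c @^-1` (W `&` chart_dom c)).
  apply: (ci _ (mem_set cq)); rewrite chart_inv_map //.
  by apply: open_nbhs_nbhs; split; [exact: openI|].
apply: filterS2 n1 n2 => _ [p dp <-]; rewrite /= chart_inv_map // => -[Wp _].
by exists p.
Qed.

Lemma open_chart_preimage c (W : set M) (V : set 'rV[R]_n) :
  is_chart c -> open W -> open V ->
  open (W `&` chart_dom c `&` chart_map c @^-1` V).
Proof.
move=> [od _ _ cm _] oW oV; rewrite openE => p [[Wp dp] Vp].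
have n1 : nbhs p (W `&` chart_dom c) by apply: open_nbhs_nbhs; split; [exact: openI|].
have n2 : nbhs p (chart_map c @^-1` V).
  by apply: (cm _ (mem_set dp)); exact: open_nbhs_nbhs.
by apply: filterS2 n1 n2 => z.
Qed.

End ChartTopology.

Section ChartChange.
Context {R : realType} {n : nat} {M : manifold R n}.
Implicit Types (c e : chart R n M) (q : M).

Lemma overlap_open c e : atlas c -> atlas e -> open (overlap c e).
Proof.
move=> ac ae; rewrite /overlap setIC; apply: open_chart_image; first exact: atlas_chart.
by have [] := atlas_chart ae.
Qed.

Lemma transition_map c e q : atlas e -> chart_dom e q ->
  transition e c (chart_map e q) = chart_map c q.
Proof. by move=> ae dq; rewrite /transition /= chart_inv_map //; exact: atlas_chart. Qed.

(** The two coordinate expressions of [f] differ by the transition map only near the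
    point, on the image of the overlap. *)
Lemma partial_chart_change c e q (f : M -> R) a :
  atlas c -> atlas e -> chart_dom c q -> chart_dom e q ->
  differentiable (f \o chart_inv c) (chart_map c q) ->
  partial a (f \o chart_inv e) (chart_map e q) =
  \sum_j 'J (transition e c) (chart_map e q) a j
    * partial j (f \o chart_inv c) (chart_map c q).
Proof.
move=> ac ae cq dq df.
have oq : overlap e c (chart_map e q) by exists q.
have dphi : differentiable (transition e c) (chart_map e q).
  exact: smooth_differentiable (atlas_smooth ae ac) oq.
have -> : partial a (f \o chart_inv e) (chart_map e q) =
    partial a ((f \o chart_inv c) \o transition e c) (chart_map e q).
  apply: near_eq_derive.
  have n1 : nbhs (chart_map e q) (overlap e c).
    by apply: open_nbhs_nbhs; split => //; exact: overlap_open.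
  apply: (filterS (F := nbhs (chart_map e q)) _ n1) => _ [p [ep cp] <-].
  rewrite /transition /= (chart_inv_map (atlas_chart ae) ep).
  by rewrite (chart_inv_map (atlas_chart ac) cp).
rewrite partial_comp // ?transition_map //.
by apply: eq_bigr => j _; rewrite mulrC jacobianE.
Qed.

Variable g : riemannian_metric M.

Lemma metric_mxsmooth c : atlas c -> mxsmooth (chart_cod c) (metric_comp g c).
Proof.
move=> ac; apply: smooth_mxsmooth; last exact: metric_smooth.
by have [] := atlas_chart ac.
Qed.

Lemma metric_is_posdef c x : atlas c -> chart_cod c x -> posdef (metric_comp g c x).
Proof. by move=> ac cx v; exact: metric_posdef. Qed.

Lemma metric_chart_change c e q : atlas c -> atlas e -> chart_dom c q ->
  chart_dom e q ->
  metric_comp g e (chart_map e q) = 'J (transition e c) (chart_map e q)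
    *m metric_comp g c (chart_map c q) *m ('J (transition e c) (chart_map e q))^T.
Proof.
move=> ac ae cq dq.
have oq : overlap e c (chart_map e q) by exists q.
by rewrite (metric_transform g ae ac oq) transition_map.
Qed.

Lemma invmx_congruence (J A : 'M[R]_n) : J *m A *m J^T \in unitmx ->
  J^T *m invmx (J *m A *m J^T) *m J = invmx A.
Proof.
move=> u; have := u; rewrite !unitmx_mul => /andP[/andP[uJ uA] uJT].
rewrite -[LHS](mulmxK uA).
suff -> : J^T *m invmx (J *m A *m J^T) *m J *m A = 1%:M by rewrite mul1mx.
rewrite -[LHS](mulmxK uJT) -(mulmxA _ J A) -(mulmxA _ (J *m A)).
by rewrite mulmxKV // mulmxV.
Qed.

(** The height function is chosen in one chart, while the inequality
    [|dh| < 1] is required in all of them. *)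
Lemma grad_sqnorm_chart_change c e q (f : M -> R) :
  atlas c -> atlas e -> chart_dom c q -> chart_dom e q ->
  differentiable (f \o chart_inv c) (chart_map c q) ->
  grad_sqnorm (metric_comp g e) (f \o chart_inv e) (chart_map e q) =
  grad_sqnorm (metric_comp g c) (f \o chart_inv c) (chart_map c q).
Proof.
move=> ac ae cq dq df; rewrite !grad_sqnormE.
set J := 'J (transition e c) (chart_map e q).
have -> : differential_row (f \o chart_inv e) (chart_map e q) =
    differential_row (f \o chart_inv c) (chart_map c q) *m J^T.
  apply/rowP => a; rewrite mxE (partial_chart_change a ac ae cq dq df) mxE.
  by apply: eq_bigr => j _; rewrite !mxE mulrC.
have ecod : chart_cod e (chart_map e q) by exists q.
have := posdef_unitmx (metric_is_posdef ae ecod).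
rewrite (metric_chart_change ac ae cq dq) -/J => u.
rewrite trmx_mul trmxK; congr (fun_of_matrix _ 0 0).
by rewrite -(invmx_congruence u) !mulmxA.
Qed.

Definition admits_local_height_function : Prop :=
  locally_on (fun W : set M => exists h : M -> R,
    scalar_field_on W h /\
    forall c : chart R n M, atlas c ->
    forall q : M, W q -> chart_dom c q ->
    let G := metric_comp g c in
    let H := h \o chart_inv c in
    let x := chart_map c q in
    (forall p i j k : 'I_n,
       (hessian G H p j x * hessian G H i k x
        - hessian G H p k x * hessian G H i j x) / (1 - grad_sqnorm G H x)
       = riemann G p i j k x) /\
    grad_sqnorm G H x < 1).

(** The coordinate is chosen at [q], where the trace of the normal projector is
    1, and keeps a gradient of norm less than 1 on a neighbourhood by continuity.
    The equation itself holds in every chart. *)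
Theorem height_function_of_immersion :
  admits_local_isometric_immersion g n.+1 -> admits_local_height_function.
Proof.
move=> imm q; have [W [oW Wq [u [su ug]]]] := imm q.
have [c ac cq] := atlas_cover q.
pose D e := chart_map e @` (W `&` chart_dom e).
have oD e : atlas e -> open (D e).
  by move=> ae; apply: open_chart_image => //; exact: atlas_chart.
have Dcod e x : D e x -> chart_cod e x by move=> [p [_ dp] <-]; exists p.
have sG e : atlas e -> mxsmooth (D e) (metric_comp g e).
  by move=> ae; apply: mxsmooth_sub (metric_mxsmooth ae); exact: Dcod.
have symG e x : atlas e -> D e x -> (metric_comp g e x)^T = metric_comp g e x.
  by move=> ae /Dcod ex; exact: (Defs.metric_sym g ae ex).
have unitG e x : atlas e -> D e x -> metric_comp g e x \in unitmx.
  by move=> ae /Dcod ex; exact: posdef_unitmx (metric_is_posdef ae ex).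
have WG e x : atlas e -> D e x ->
    (immersion_mx (fun t => u t \o chart_inv e) x)^T *m
      immersion_mx (fun t => u t \o chart_inv e) x = metric_comp g e x.
  move=> ae [p [Wp dp] <-]; apply/matrixP => a b; rewrite -(ug e ae p Wp dp) mxE.
  by apply: eq_bigr => t _; rewrite !mxE.
have Dq : D c (chart_map c q) by exists q.
have [t t1] : exists t, grad_sqnorm (metric_comp g c) (u t \o chart_inv c)
    (chart_map c q) < 1.
  apply: contrapT => none.
  have := normal_projector_trace (fun x => unitG c x ac) (fun x => WG c x ac) Dq.
  rewrite /mxtrace -natrB // subSnn.
  have : \sum_i normal_projector (metric_comp g c) (fun t => u t \o chart_inv c)
      (chart_map c q) i i <= 0.
    apply: sumr_le0 => t _; rewrite normal_projector_diag subr_le0 leNgt.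
    by apply/negP => t1; apply: none; exists t.
  by move=> le0 E; move: le0; rewrite E ler10.
have sgrad : smooth_on (D c) (fun x => grad_sqnorm (metric_comp g c)
    (u t \o chart_inv c) x).
  have sd := differential_row_smooth (oD c ac) (su t c ac).
  have s1 := mxsmoothM (oD c ac) (mxsmoothM (oD c ac) sd
    (mxsmooth_inv (oD c ac) (sG c ac) (fun x => unitG c x ac)))
    (mxsmoothT (oD c ac) sd).
  by apply: smooth_ext (s1 0 0) => [|x _]; [exact: oD|rewrite grad_sqnormE].
have e0 : 0 < 1 - grad_sqnorm (metric_comp g c) (u t \o chart_inv c)
    (chart_map c q) by rewrite subr_gt0.
have [r r0 rP] := smooth_ball sgrad Dq e0.
pose W' := W `&` chart_dom c `&` chart_map c @^-1` ball (chart_map c q) r.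
exists W'; split.
- apply: open_chart_preimage => //; first exact: atlas_chart.
  exact: ball_open.
- by split=> //; exact: ballxx.
exists (u t); split.
  move=> e ae; apply: smooth_sub (su t e ae) => _ [p [[[Wp _] _] dp] <-].
  by exists p.
move=> e ae p [[Wp cp] bp] dp /=.
have Dp : D e (chart_map e p) by exists p.
have Dcp : D c (chart_map c p) by exists p.
have lt1 : grad_sqnorm (metric_comp g e) (u t \o chart_inv e) (chart_map e p) < 1.
  rewrite (grad_sqnorm_chart_change ac ae cp dp); last first.
    exact: smooth_differentiable (su t c ac) Dcp.
  have := rP _ bp; move: (grad_sqnorm _ _ _) (grad_sqnorm _ _ _) => A B.
  by rewrite distrC => /(le_lt_trans (ler_norm _)); rewrite ltrBlDr subrK.
split=> // i j k l.
rewrite (hypersurface_gauss (oD e ae) (sG e ae) (fun x => symG e x ae)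
  (fun x => unitG e x ae) (fun t => su t e ae) (fun x => WG e x ae)) //.
by rewrite mulrAC divff ?mul1r // subr_eq0 eq_sym lt_eqF.
Qed.

End ChartChange.

(** * The immersion built from a height function *)

Section GraphRealization.
Context {R : realType} {n : nat} {M : manifold R n}.
Variable g : riemannian_metric M.

(** The flat coordinates are found in one chart around the point.  The other charts
    are reached by the transformation law of the metric. *)
Theorem immersion_of_height_function :
  admits_local_height_function g -> admits_local_isometric_immersion g n.+1.
Proof.
move=> loc q; have [W [oW Wq [h [sh hg]]]] := loc q.
have [c ac cq] := atlas_cover q.
have hc := atlas_chart ac.
pose D := chart_map c @` (W `&` chart_dom c).
have oD : open D by exact: open_chart_image.
have Dcod x : D x -> chart_cod c x by move=> [p [_ dp] <-]; exists p.
pose G := metric_comp g c; pose H := h \o chart_inv c.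
have sG : mxsmooth D G by apply: mxsmooth_sub (metric_mxsmooth g ac); exact: Dcod.
have symG x : D x -> (G x)^T = G x by move=> /Dcod cx; exact: (Defs.metric_sym g ac cx).
have posG x : D x -> posdef (G x) by move=> /Dcod cx; exact: metric_is_posdef.
have unitG x : D x -> G x \in unitmx by move=> /posG; exact: posdef_unitmx.
have sH : smooth_on D H by exact: sh.
have nuE x : conorm G H x = 1 - grad_sqnorm G H x.
  by rewrite /conorm /gradient mulmxA grad_sqnormE.
have nu_gt0 x : D x -> 0 < conorm G H x.
  move=> [p [Wp dp] <-]; rewrite nuE subr_gt0.
  by have [_] := hg c ac p Wp dp.
have gauss j k x : D x ->
    conorm G H x *: (G x *m curvature_mx G j k x) =
    (hessian_row G H j x)^T *m hessian_row G H k x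
      - (hessian_row G H k x)^T *m hessian_row G H j x.
  move=> Dx; have nu0 := nu_gt0 x Dx.
  have E : forall p i, conorm G H x * riemann G p i j k x =
      hessian_row G H j x 0 p * hessian_row G H k x 0 i
      - hessian_row G H k x 0 p * hessian_row G H j x 0 i.
    move=> p i.
    have F : conorm G H x * riemann G p i j k x =
        hessian G H p j x * hessian G H i k x - hessian G H p k x * hessian G H i j x.
      have [y [Wy dy] yx] := Dx.
      have [/(_ p i j k) + _] := hg c ac y Wy dy; rewrite yx => <-.
      by rewrite nuE mulrC divfK // -nuE gt_eqF.
    apply: etrans F _.
    by congr (_ * _ - _ * _); exact: (hessian_rowE oD symG H _ _ Dx).
  have O (k1 k2 : 'rV[R]_n) p i : (k1^T *m k2) p i = k1 0 p * k2 0 i.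
    by rewrite mxE big_ord1 mxE.
  apply/matrixP => p i; have L : (conorm G H x *: (G x *m curvature_mx G j k x)) p i =
      conorm G H x * riemann G p i j k x by rewrite mxE riemannE.
  apply: etrans L _; apply: etrans (E p i) _; apply/esym.
  apply: etrans (mx_subE _ _ _ _) _.
  by congr (_ - _); exact: O.
have Dq : D (chart_map c q) by exists q.
have [r r0 [rD [u [su ug]]]] :=
  graph_local_isometry oD Dq sG symG posG sH nu_gt0 gauss.
pose B := ball (chart_map c q) r.
pose W' := W `&` chart_dom c `&` chart_map c @^-1` B.
(* Coordinate 0 is the height function, coordinate [s + 1] is the flat
   coordinate [u s]. *)
pose v (t : 'I_n.+1) (p : M) : R :=
  oapp (fun s => u s (chart_map c p)) (h p) (unlift ord0 t).
have vs s : v (lift ord0 s) = u s \o chart_map c.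
  by apply/funext => p; rewrite /v liftK.
have v0 : v ord0 = h by apply/funext => p; rewrite /v unlift_none.
have oW' : open W' by apply: open_chart_preimage => //; exact: ball_open.
have sv t : scalar_field_on W' (v t).
  move=> e ae; have oe : open (chart_map e @` (W' `&` chart_dom e)).
    by apply: open_chart_image => //; exact: atlas_chart.
  case: (unliftP ord0 t) => [s|] ->; last first.
    rewrite v0; apply: smooth_sub (sh e ae) => _ [p [[[Wp _] _] dp] <-].
    by exists p.
  rewrite vs; apply: (smooth_comp (V := B) (phi := transition e c)) => //.
    by move=> _ [p [[_ bp] dp] <-]; rewrite transition_map.
  apply: smooth_sub (atlas_smooth ae ac) => _ [p [[[_ cp] _] dp] <-].
  by exists p.
exists W'; split=> //; first by split=> //; exact: ballxx.
exists v; split=> // e ae p W'p ep a b.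
have [[Wp cp] bp] := W'p.
have oc : open (chart_map c @` (W' `&` chart_dom c)) by exact: open_chart_image.
have cW' : (chart_map c @` (W' `&` chart_dom c)) (chart_map c p) by exists p.
have dv t : differentiable (v t \o chart_inv c) (chart_map c p).
  exact: smooth_differentiable (sv t c ac) cW'.
have in_c i j : \sum_t partial i (v t \o chart_inv c) (chart_map c p)
    * partial j (v t \o chart_inv c) (chart_map c p) = G (chart_map c p) i j.
  rewrite big_ord_recl v0 addrC -(ug (chart_map c p) i j bp); congr (_ + _).
  apply: eq_bigr => s _.
  have E k : partial k (v (lift ord0 s) \o chart_inv c) (chart_map c p) =
      partial k (u s) (chart_map c p).
    apply: near_eq_derive.
    have n1 : nbhs (chart_map c p) (chart_map c @` (W' `&` chart_dom c)).
      exact: open_nbhs_nbhs.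
    apply: (filterS (F := nbhs (chart_map c p)) _ n1) => _ [y [_ dy] <-].
    by rewrite vs /= chart_inv_map.
  by rewrite !E.
rewrite (metric_chart_change g ac ae cp ep).
set J := 'J (transition e c) (chart_map e p).
have pE t k : partial k (v t \o chart_inv e) (chart_map e p) =
    \sum_j J k j * partial j (v t \o chart_inv c) (chart_map c p).
  exact: partial_chart_change.
have -> : (J *m G (chart_map c p) *m J^T) a b =
    \sum_i \sum_j J a i * J b j * G (chart_map c p) i j.
  rewrite mxE exchange_big; apply: eq_bigr => j _.
  rewrite mxE mulr_suml; apply: eq_bigr => i _; rewrite [J^T _ _]mxE.
  by rewrite mulrAC.
under eq_bigr => t _ do rewrite !pE mulr_suml.
rewrite exchange_big; apply: eq_bigr => i _.
under eq_bigr => t _ do rewrite mulr_sumr.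
rewrite exchange_big; apply: eq_bigr => j _.
rewrite -in_c mulr_sumr; apply: eq_bigr => t _.
by rewrite mulrACA.
Qed.

End GraphRealization.

Theorem theorem3p1 (R : realType) (n : nat) (M : manifold R n)
    (g : riemannian_metric M) :
  admits_local_isometric_immersion g n.+1 <->
  locally_on (fun W : set M => exists h : M -> R,
    scalar_field_on W h /\
    forall c : chart R n M, atlas c ->
    forall q : M, W q -> chart_dom c q ->
    let G := metric_comp g c in
    let H := h \o chart_inv c in
    let x := chart_map c q in
    (forall p i j k : 'I_n,
       (hessian G H p j x * hessian G H i k x
        - hessian G H p k x * hessian G H i j x) / (1 - grad_sqnorm G H x)
       = riemann G p i j k x) /\
    grad_sqnorm G H x < 1).
Proof.
split; first exact: height_function_of_immersion.
exact: immersion_of_height_function.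
Qed.
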